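(* Let $K$ be a field, $R=K[x_1,\dots,x_n]$ a standard graded polynomial ring, and let $I_1,\dots,I_m$ be non-zero homogeneous ideals of $R$. For $a=(a_1,\dots,a_m)\in\mathbb{N}^m$ write $I^a=I_1^{a_1}\cdots I_m^{a_m}$. Suppose that each $I_i$ is generated in a single degree, say $d_i$. Then $\operatorname{pd}_R(I^a)$ is constant for $a\gg 0$, say equal to $p$, and for each $j$ with $0\le j\le p$ there exists a linear polynomial $L^{(j)}(u)=\sum_{i=1}^m d_iu_i+\lambda^{(j)}_0$ with $\lambda^{(j)}_0\in\mathbb{Z}$ such that $$t_j^R(I^a)=L^{(j)}(a)\quad\text{for } a\gg 0.$$ In particular, there exists a linear polynomial $L(u)=\sum_{i=1}^m d_iu_i+\lambda_0$ with $\lambda_0\in\mathbb{Z}$ such that $$\operatorname{reg}(I^a)=L(a)\quad\text{for } a\gg 0.$$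
   Context: $\mathbb{N}$ contains $0$. A formula or property is said to hold for $a\gg 0$ if there exists $b\in\mathbb{N}^m$ such that it holds for every $a\in b+\mathbb{N}^m$. For a finitely generated graded non-zero $R$-module $M$ and an integer $0\le j\le\operatorname{pd}_R(M)$ (projective dimension), $t_j^R(M)$ denotes the largest degree of a minimal generator of the $j$-th syzygy module of $M$ (in the minimal graded free resolution; the $0$-th syzygy module is $M$ itself); by convention $t_j^R(M)=-\infty$ if $j>\operatorname{pd}_R(M)$. The Castelnuovo-Mumford regularity is $\operatorname{reg}(M)=\operatorname{reg}_R(M)=\max\{t_j^R(M)-j: j\ge 0\}$. *)

(* Defs.v *)
From HB Require Import structures.
From mathcomp Require Import all_boot all_order all_algebra.
From mathcomp Require Export mpoly.

Set Implicit Arguments.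
Unset Strict Implicit.
Unset Printing Implicit Defensive.

Import Order.TTheory GRing.Theory Num.Theory.
Local Open Scope ring_scope.

(* Ideals are Prop-valued predicates: those of [ring_quotient] are decidable
   and proper, and the unit ideal has to be allowed here. *)
Section Ideals.
Variable A : comNzRingType.

Definition is_ideal (I : A -> Prop) : Prop :=
  [/\ I 0, (forall f g, I f -> I g -> I (f + g))
    & (forall c f, I f -> I (c * f))].

Definition ideal_gen (G : A -> Prop) (f : A) : Prop :=
  exists s : seq (A * A),
    (forall u, u \in s -> G u.2) /\ f = \sum_(u <- s) u.1 * u.2.

Definition ideal_one (_ : A) : Prop := True.

Definition ideal_mul (I J : A -> Prop) (f : A) : Prop :=
  exists s : seq (A * A),
    (forall u, u \in s -> I u.1 /\ J u.2) /\ f = \sum_(u <- s) u.1 * u.2.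

Definition ideal_pow (I : A -> Prop) (k : nat) : A -> Prop :=
  iter k (ideal_mul I) ideal_one.

Definition ideal_mpow (m : nat) (I : 'I_m -> A -> Prop) (a : 'I_m -> nat) :
  A -> Prop :=
  \big[ideal_mul/ideal_one]_(i < m) ideal_pow (I i) (a i).

End Ideals.

Section ProjectiveDimension.
Variable A : comNzRingType.

Definition projective_module (P : lmodType A) : Prop :=
  forall (M N : lmodType A) (g : {linear M -> N}) (f : {linear P -> N}),
    (forall y, exists x, g x = y) ->
    exists h : {linear P -> M}, forall x, g (h x) = f x.

(* The submodule M of V has a projective resolution
   0 -> P_q -> ... -> P_0 -> M -> 0. *)
Definition pd_le (V : lmodType A) (M : V -> Prop) (q : nat) : Prop :=
  exists (P : nat -> lmodType A)
         (delta : forall j, {linear P j.+1 -> P j})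
         (eps : {linear P 0%N -> V}),
    [/\ forall j, projective_module (P j),
        forall j, (q < j)%N -> forall x : P j, x = 0,
        forall y, M y <-> exists x, eps x = y,
        forall x, eps x = 0 <-> exists z, delta 0%N z = x
      & forall j x, delta j x = 0 <-> exists z, delta j.+1 z = x].

Definition is_pd (V : lmodType A) (M : V -> Prop) (p : nat) : Prop :=
  pd_le M p /\ forall q, pd_le M q -> (p <= q)%N.

End ProjectiveDimension.

Section Graded.
Variables (K : fieldType) (n : nat).
Local Notation R := {mpoly K[n]}.

Definition homogeneous_ideal (I : R -> Prop) : Prop :=
  is_ideal I /\ forall f k, I f -> I (pihomog mdeg k f).

Definition generated_in_degree (I : R -> Prop) (d : nat) : Prop :=
  exists G : R -> Prop,
    (forall g, G g -> g \is d.-homog) /\ forall f, I f <-> ideal_gen G f.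

Definition homogZ (z : int) (f : R) : Prop :=
  match z with
  | Posz k => f \is k.-homog
  | Negz _ => f = 0
  end.

(* The free module F_j = sum_k R(- gf_deg k) of row vectors, whose k-th basis
   vector has degree [gf_deg k]; matrices act on rows from the right. *)
Record graded_free_complex := GradedFreeComplex {
  gf_rank : nat -> nat;
  gf_deg : forall j, 'I_(gf_rank j) -> int;
  gf_diff : forall j, 'M[R]_(gf_rank j.+1, gf_rank j);
  gf_aug : 'cV[R]_(gf_rank 0%N);
  gf_diff_homog : forall j i k,
    homogZ (gf_deg i - gf_deg k) (gf_diff j i k);
  gf_aug_homog : forall i, homogZ (gf_deg i) (gf_aug i 0)
}.

Definition is_graded_free_resolution
    (I : R -> Prop) (F : graded_free_complex) : Prop :=
  [/\ forall f, I f <-> exists u : 'rV_(gf_rank F 0%N), (u *m gf_aug F) 0 0 = f,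
      forall u : 'rV_(gf_rank F 0%N),
        u *m gf_aug F = 0 <-> exists v, u = v *m gf_diff F 0%N
    & forall j (u : 'rV_(gf_rank F j.+1)),
        u *m gf_diff F j = 0 <-> exists v, u = v *m gf_diff F j.+1].

(* Minimality: the differentials have entries in (x_1, ..., x_n). *)
Definition is_minimal_resolution
    (I : R -> Prop) (F : graded_free_complex) : Prop :=
  is_graded_free_resolution I F /\
  forall j i k, (gf_diff F j i k)@_0%MM = 0.

(* [is_t I j t] reads t_j(I) = t. The basis of F_j maps to a minimal system of
   homogeneous generators of the j-th syzygy module, in the degrees
   [gf_deg F j]. When F_j = 0, i.e. t_j(I) = -oo, no integer t qualifies. *)
Definition is_t (I : R -> Prop) (j : nat) (t : int) : Prop :=
  exists2 F : graded_free_complex, is_minimal_resolution I F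
    & (exists k, @gf_deg F j k = t) /\ (forall k, @gf_deg F j k <= t).

(* [is_reg I r] reads reg(I) = r; the values t_j(I) = -oo do not contribute
   to the maximum. *)
Definition is_reg (I : R -> Prop) (r : int) : Prop :=
  (exists j t, is_t I j t /\ r = t - j%:Z) /\
  (forall j t, is_t I j t -> t - j%:Z <= r).

(* The projective dimension over R of I, as a submodule of R. *)
Definition is_pd_ideal (I : R -> Prop) (p : nat) : Prop :=
  is_pd (A := R) (V := R^o) I p.

End Graded.

Definition for_large (m : nat) (P : ('I_m -> nat) -> Prop) : Prop :=
  exists b : 'I_m -> nat,
    forall a : 'I_m -> nat, (forall i, (b i <= a i)%N) -> P a.

(* Main.v *)
Require Import Defs.
From HB Require Import structures.
From mathcomp Require Import all_boot all_order all_algebra.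
From mathcomp Require Import mpoly.
From mathcomp Require freeg.
From mathcomp Require Import ring.
From Stdlib Require Import Classical ClassicalEpsilon.
From Stdlib Require Import FunctionalExtensionality PropExtensionality.

Set Implicit Arguments.
Unset Strict Implicit.
Unset Printing Implicit Defensive.

Import Order.TTheory GRing.Theory Num.Theory.
Local Open Scope ring_scope.

(** The numbers t_j of a homogeneous ideal are visible in its Koszul homology.
    Cut a minimal graded free resolution F of I into short exact sequences: as
    the Koszul complex of a free module is exact in positive degrees, the
    connecting maps identify the j-th Koszul homology of I with the j-th
    syzygy module modulo its multiple by (x_1, ..., x_n), so that it is
    non-zero in exactly the degrees of the basis of F_j
    ([koszul_vanish_betti]). It vanishes for j > n, because chains are indexed
    by subsets of the variables. The same dimension shifting along an
    arbitrary projective resolution shows that it vanishes beyond the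
    projective dimension ([pd_le_koszul_exact]), which is therefore the length
    of F.

    Let now I_1, ..., I_m be generated in the degrees d_1, ..., d_m and write
    d.a for the sum of the d_i a_i. A Koszul cycle with values in I^a is a
    Koszul cycle of R, a condition independent of a, whose values lie in I^a.
    By an argument of Artin-Rees type, which uses that a polynomial ring over
    R that maps onto the Rees algebra is noetherian, there is a bound beyond
    which every cycle with values in I_i I^a is a combination of cycles with
    values in I^a with coefficients in the generators of I_i
    ([powers_stable]). These generators have degree d_i and multiply
    boundaries into boundaries. Hence, if the homology of I^a vanishes in
    degree d.a + e, then that of I_i I^a vanishes in degree d.a + d_i + e
    ([prod_vanish_step]): counted from d.a, the set of degrees in which the
    homology of I^a lives can only shrink when a grows. It is finite at the
    bound, since F_j has finite rank there, and so it is constant for large a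
    ([shifts_stabilise]). The greatest element of this constant set is the
    constant term of L^(j), and p is the largest j for which it is not empty.

    What remains is the commutative algebra that gives these statements
    their meaning: Hilbert's basis theorem, the exactness of the Koszul
    complex, and the existence of minimal graded free resolutions. *)

(** * Noetherian modules *)

Section Span.
Variables (A : comNzRingType) (V : lmodType A).
Implicit Types (U : V -> Prop) (s t : seq V) (u v : V) (c : A).

Definition submodule U := U 0 /\ forall c u v, U u -> U v -> U (c *: u + v).

Fixpoint in_span s u : Prop :=
  if s is v :: s' then exists c, in_span s' (u - c *: v) else u = 0.

(** The generators are required to lie in [U], so that, for a submodule, this
    says that [U] is equal to their span. *)
Definition finitely_generated U :=
  exists s, (forall v, v \in s -> U v) /\ (forall u, U u -> in_span s u).

Lemma submoduleD U u v : submodule U -> U u -> U v -> U (u + v).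
Proof. by move=> [_ H] Hu Hv; rewrite -[u]scale1r; apply: H. Qed.

Lemma submoduleZ U c u : submodule U -> U u -> U (c *: u).
Proof. by move=> [H0 H] Hu; rewrite -[c *: u]addr0; apply: H. Qed.

Lemma submoduleB U u v : submodule U -> U u -> U v -> U (u - v).
Proof.
by move=> HU Hu Hv; rewrite addrC -scaleN1r; apply: HU.2.
Qed.

Lemma submodule_sum U (I : Type) (r : seq I) (P : pred I) (F : I -> V) :
  submodule U -> (forall i, P i -> U (F i)) -> U (\sum_(i <- r | P i) F i).
Proof.
move=> HU HF; elim/big_ind: _ => //; first by case: HU.
by move=> u v; apply: submoduleD.
Qed.

Lemma span_submodule s : submodule (in_span s).
Proof.
elim: s => [|w s IH]; split => /=; first by [].
- by move=> c u v -> ->; rewrite scaler0 addr0.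
- by exists 0; rewrite scale0r subr0; case: IH.
- move=> c u v [a Ha] [b Hb]; exists (c * a + b).
  rewrite scalerDl -scalerA opprD addrACA -scalerBr.
  exact: IH.2.
Qed.

Lemma span_mem s v : v \in s -> in_span s v.
Proof.
elim: s => // w s IH; rewrite inE => /orP[/eqP-> | /IH Hv].
  by exists 1; rewrite scale1r subrr; case: (span_submodule s).
by exists 0; rewrite scale0r subr0.
Qed.

Lemma span_min U s u :
  submodule U -> (forall v, v \in s -> U v) -> in_span s u -> U u.
Proof.
move=> HU; elim: s u => [|w s IH] u Hs /=; first by move=> ->; case: HU.
move=> [c Hc]; rewrite -[u](subrK (c *: w)) addrC.
apply: HU.2; first by apply: Hs; rewrite mem_head.
by apply: IH => // v vs; apply: Hs; rewrite inE vs orbT.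
Qed.

Lemma span_sub s t u : {subset s <= t} -> in_span s u -> in_span t u.
Proof.
move=> st; apply: span_min; first exact: span_submodule.
by move=> v /st; apply: span_mem.
Qed.

Lemma span_catD s t u v : in_span s u -> in_span t v -> in_span (s ++ t) (u + v).
Proof.
move=> Hu Hv; apply: submoduleD; first exact: span_submodule.
  by apply: span_sub Hu => x xs; rewrite mem_cat xs.
by apply: span_sub Hv => x xs; rewrite mem_cat xs orbT.
Qed.

Lemma spanE s u :
  in_span s u -> exists c : 'I_(size s) -> A, u = \sum_i c i *: s`_i.
Proof.
elim: s u => [|w s IH] u /=.
  by move=> ->; exists (fun=> 0); rewrite big_ord0.
move=> [c /IH[d Hd]].
exists (fun i => if unlift ord0 i is Some j then d j else c).
rewrite big_ord_recl unlift_none /=; apply/eqP; rewrite addrC -subr_eq Hd.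
by apply/eqP/eq_bigr => i _; rewrite liftK.
Qed.

End Span.

Definition noetherian (A : comNzRingType) :=
  forall J : A^o -> Prop, submodule J -> finitely_generated J.

(** Induction on the number of generators: the coefficients of the first one
    in the elements of [U] form an ideal, and the elements of [U] that do
    without it are spanned by the others. *)
Lemma noetherian_span (A : comNzRingType) (V : lmodType A) (s : seq V)
    (U : V -> Prop) :
  noetherian A -> submodule U -> (forall u, U u -> in_span s u) ->
  finitely_generated U.
Proof.
move=> noethA; elim: s U => [|v s IH] U HU Us.
  by exists [::]; split => // u /Us.
(* The coefficients of [v], taken modulo the other generators. *)
pose J (c : A^o) := exists2 u, U u & in_span s (u - c *: v).
have Jsub : submodule J.
  split; first by exists 0; [case: HU | rewrite scale0r subr0; case: (span_submodule s)].
  move=> c a b [x Ux Hx] [y Uy Hy]; exists (c *: x + y); first exact: HU.2.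
  rewrite scalerDl -scalerA opprD addrACA -scalerBr.
  exact: (span_submodule s).2.
have [cs [Jcs csJ]] := noethA _ Jsub.
(* Elements of [U] whose coefficients of [v] generate [J]. *)
have [us Uus Hus] : exists2 us : seq V, (forall u, u \in us -> U u) &
    forall c, in_span cs c -> exists2 u, in_span us u & in_span s (u - c *: v).
  elim: cs Jcs {csJ} => [|a cs IHc] Jcs.
    by exists [::] => // c ->; exists 0; rewrite ?scale0r ?subrr //;
       case: (span_submodule s).
  have [|us Uus Hus] := IHc; first by move=> c cc; apply: Jcs; rewrite inE cc orbT.
  have [x Ux Hx] := Jcs a (mem_head _ _).
  exists (x :: us) => [u|c [b /Hus[y Hy Hyc]]].
    by rewrite inE => /orP[/eqP->|/Uus].
  exists (b *: x + y); first by exists b; rewrite addrAC subrr add0r.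
  have -> : b *: x + y - c *: v
      = b *: (x - (a : A) *: v) + (y - (c - b *: a) *: v).
    by rewrite scalerBr scalerA scalerBl opprB addrACA addKr.
  exact: (span_submodule s).2.
have [] := IH (fun u => U u /\ in_span s u).
- split; first by split; [case: HU | case: (span_submodule s)].
  by move=> c x y [? ?] [? ?]; split; [apply: HU.2 | apply: (span_submodule s).2].
- by move=> u [].
move=> t [Ut tU]; exists (us ++ t); split.
  by move=> u; rewrite mem_cat => /orP[/Uus|/Ut[]].
move=> u Uu; have [c Hc] := Us u Uu.
have /csJ/Hus[w Hw Hwc] : J c by exists u.
rewrite -[u](subrK w) addrC; apply: span_catD => //; apply: tU; split.
  by apply: submoduleB => //; apply: span_min Hw.
have -> : u - w = (u - c *: v) - (w - c *: v) by rewrite opprB addrA subrK.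
exact: submoduleB (span_submodule s) Hc Hwc.
Qed.

Lemma noetherian_field (K : fieldType) : noetherian K.
Proof.
move=> J HJ; have [[x Jx x0]|J0] := classic (exists2 x, J x & x != 0).
  exists [:: x]; split=> [v|u _]; first by rewrite inE => /eqP->.
  by exists (u / x); rewrite /= /GRing.scale /= divfK ?subrr.
exists [::]; split=> // u Ju /=; apply/eqP; apply: contra_notT J0 => u0.
by exists u.
Qed.

Lemma noetherian_surj (A B : comNzRingType) (h : {rmorphism A -> B}) :
  (forall b, exists a, h a = b) -> noetherian A -> noetherian B.
Proof.
move=> hsurj noethA J HJ.
have [] := noethA (fun a => J (h a)).
  split; first by rewrite rmorph0; case: HJ.
  by move=> c a b; rewrite rmorphD rmorphM; apply: HJ.2.
move=> s [Js sJ]; exists (map h s); split.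
  by move=> v /mapP[a /Js Ja ->].
move=> u; have [a <-] := hsurj u => /sJ.
elim: s a {Js sJ} => [a /= ->|b s IH a [c /IH]] /=; first by rewrite rmorph0.
by rewrite rmorphB rmorphM; exists (h c).
Qed.

(** Hilbert's basis theorem. The leading coefficients of an ideal form an
    ideal of [A]; finitely many polynomials of degree at most [n0] realise it,
    and subtracting their multiples lowers the degree of any other one until
    it is less than [n0], where the ideal is a submodule of a finitely
    generated [A]-module. *)
Lemma noetherian_poly (A : comNzRingType) : noetherian A -> noetherian {poly A}.
Proof.
move=> noethA J HJ.
have JM (c u : {poly A}) : J u -> J (c * u).
  exact: (@submoduleZ _ _ J c u HJ).
have JD (u v : {poly A}) : J u -> J v -> J (u + v).
  exact: (@submoduleD _ _ J u v HJ).
(* The index [n] need not be the degree of [f], so that [L] contains 0 and is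
   stable under sums. *)
pose L (c : A^o) := exists2 f : {poly A}, J f & exists2 n, (size f <= n.+1)%N & f`_n = c.
have shift (f : {poly A}) n k : (size f <= n.+1)%N ->
    (size ('X^k * f)%R <= (n + k).+1)%N /\ ('X^k * f)`_(n + k) = f`_n.
  move=> sf; rewrite coefXnM ltnNge leq_addl addnK; split=> //.
  apply: leq_trans (size_polyMleq _ _) _.
  by rewrite size_polyXn addSn /= -addSn [(k + _)%N]addnC leq_add2r.
have Lsub : submodule L.
  split; first by exists 0; [case: HJ | exists 0%N; rewrite ?size_poly0 ?coef0].
  move=> c _ _ [f Jf [n sf <-]] [g Jg [k sg <-]].
  rewrite /GRing.scale /=; exists (c%:P * ('X^k * f) + 'X^n * g).
    by apply: JD; [apply/JM/JM | apply: JM].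
  have [s1 e1] := shift f n k sf; have [s2 e2] := shift g k n sg.
  exists (n + k)%N; last by rewrite coefD coefCM e1 addnC e2.
  apply: leq_trans (size_polyD _ _) _; rewrite geq_max [in X in _ && X]addnC s2 andbT.
  by rewrite mul_polyC; apply: leq_trans (size_scale_leq _ _) s1.
have [cs [Lcs csL]] := noethA _ Lsub.
have [us Jus [n0 Hus]] : exists2 us : seq {poly A}^o, (forall u, u \in us -> J u) &
    exists n, forall c, in_span cs c ->
      exists2 f : {poly A}, in_span us f & (size f <= n.+1)%N /\ f`_n = c.
  elim: cs Lcs {csL} => [|a cs IHc] Lcs.
    by exists [::] => //; exists 0%N => c ->; exists 0; rewrite ?size_poly0 ?coef0.
  have [|us Jus [n Hus]] := IHc; first by move=> c cc; apply: Lcs; rewrite inE cc orbT.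
  have [f Jf [k sf fa]] := Lcs a (mem_head _ _).
  exists (('X^n * f : {poly A}^o) :: us) => [u|].
    by rewrite inE => /orP[/eqP->|/Jus //]; apply: JM.
  exists (n + k)%N => c [b /Hus[g Hg [sg eg]]].
  have [s1 e1] := shift f k n sf; have [s2 e2] := shift g n k sg.
  exists (b%:P * ('X^n * f) + 'X^k * g).
    exists b%:P; rewrite addrAC subrr add0r.
    by apply: (submoduleZ (U := in_span us)) Hg; apply: span_submodule.
  split; last by rewrite coefD coefCM e2 addnC e1 fa eg addrC subrK.
  apply: leq_trans (size_polyD _ _) _; rewrite geq_max s2 andbT addnC.
  by rewrite mul_polyC; apply: leq_trans (size_scale_leq _ _) s1.
(* The elements of [J] of size at most [n0], over [A]. *)
have [] := @noetherian_span A {poly A} [seq 'X^i | i <- iota 0 n0]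
   (fun f => J f /\ (size f <= n0)%N) noethA.
- split; first by rewrite size_poly0; split=> //; case: HJ.
  move=> c f g [Jf sf] [Jg sg]; split.
    by rewrite -mul_polyC; apply: JD => //; apply: JM.
  apply: leq_trans (size_polyD _ _) _; rewrite geq_max sg andbT.
  exact: leq_trans (size_scale_leq _ _) sf.
- move=> f [_ sf]; have -> : f = \sum_(i < n0) f`_i *: 'X^i.
    rewrite -poly_def; apply/polyP => i; rewrite coef_poly.
    by case: ltnP => // ni; rewrite nth_default // (leq_trans sf).
  apply: submodule_sum => [|i _]; first exact: span_submodule.
  apply: submoduleZ; first exact: span_submodule.
  by apply/span_mem/map_f; rewrite mem_iota /=.
move=> t [Jt tJ]; exists (us ++ t); split.
  by move=> u; rewrite mem_cat => /orP[/Jus|/Jt[]].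
move=> f; have [N] := ubnP (size f); elim: N f => // N IHN f sfN Jf.
have [sf|] := leqP (size f) n0.
  apply: (@span_sub _ {poly A}^o t) => [x xt|]; first by rewrite mem_cat xt orbT.
  have := tJ f (conj Jf sf); elim: (t) (f) => [//|v r IHr] h /= [c /IHr Hc].
  by exists c%:P; rewrite /GRing.scale /= mul_polyC.
case sfE : (size f) => [//|M]; rewrite ltnS => n0M.
have /csL/Hus[g Hg [sg eg]] : L f`_M by exists f => //; exists M; rewrite ?sfE.
have [s1 e1] := shift g n0 (M - n0)%N sg; rewrite subnKC // in s1 e1.
rewrite -[f](subrK ('X^(M - n0) * g)).
apply: (@submoduleD _ {poly A}^o _ _ _ (span_submodule _)); last first.
  apply: (@submoduleZ _ {poly A}^o _ _ _ (span_submodule _)).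
  by apply: (@span_sub _ {poly A}^o us) => // x xt; rewrite mem_cat xt.
apply: IHN; last first.
  apply: (@submoduleB _ {poly A}^o J) => //; apply: JM.
  exact: span_min HJ Jus Hg.
rewrite sfE ltnS in sfN; apply: leq_trans sfN; rewrite ltnS.
apply/leq_sizeP => j Mj; rewrite coefB; have [->|jM] := eqVneq j M.
  by rewrite e1 eg subrr.
have Mj' : (M.+1 <= j)%N by rewrite ltn_neqAle eq_sym jM Mj.
by rewrite !nth_default ?subrr // ?sfE //; apply: leq_trans s1 _.
Qed.

(** One variable at a time: a polynomial in [n.+1] variables is one in the last
    variable, with coefficients in the others. *)
Lemma noetherian_mpoly (A : comNzRingType) n :
  noetherian A -> noetherian {mpoly A[n]}.
Proof.
move=> noethA; elim: n => [|n IH].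
  apply: (@noetherian_surj A _ (@mpolyC 0 A)) => // p; exists p@_0%MM.
  by apply/mpolyP => m; rewrite mcoeffC (_ : m = 0%MM) ?eqxx ?mulr1 //; apply/mnmP; case.
pose h : {rmorphism {poly {mpoly A[n]}} -> {mpoly A[n.+1]}} :=
  horner_eval 'X_ord_max \o map_poly (@mwiden n A).
apply: (noetherian_surj (h := h)); last exact: noetherian_poly.
pose im q := exists p, h p = q.
have imD p q : im p -> im q -> im (p + q).
  by move=> [a <-] [b <-]; exists (a + b); rewrite rmorphD.
have imM p q : im p -> im q -> im (p * q).
  by move=> [a <-] [b <-]; exists (a * b); rewrite rmorphM.
have imC c : im c%:MP.
  by exists (c%:MP)%:P; rewrite /h /= map_polyC /= /horner_eval hornerC mwidenC.
have imX i : im 'X_i.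
  have [j ->|->] := unliftP ord_max i.
    exists ('X_j)%:P; rewrite /h /= map_polyC /= /horner_eval hornerC mwidenX mnmwiden1.
    by congr ('X_[U_(_)]); apply/val_inj => /=; rewrite /bump leqNgt ltn_ord.
  by exists 'X; rewrite /h /= map_polyX /horner_eval hornerX.
elim/mpolyind => [|c m p _ _ Hp]; first by rewrite -(mpolyC0 n.+1); apply: imC.
apply: (imD) => //; rewrite -mul_mpolyC; apply: (imM) => //.
rewrite mpolyXE_id; apply: (big_ind im) => [||i _].
- by rewrite -(mpolyC1 n.+1).
- exact: imM.
elim: (m i) => [|k IHk]; first by rewrite expr0 -(mpolyC1 n.+1).
by rewrite exprS; apply: imM.
Qed.

(** * Koszul chains *)

(** The diagonal is required to vanish, and the sum is split along it, because
    2 may be zero. *)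
Lemma sum_antisym (V : zmodType) n (F : 'I_n -> 'I_n -> V) :
  (forall i, F i i = 0) -> (forall i j, F i j = - F j i) ->
  \sum_i \sum_j F i j = 0.
Proof.
move=> F0 FN.
have split_lt i : \sum_j F i j
    = \sum_(j < n | (i < j)%N) F i j + \sum_(j < n | (j < i)%N) F i j.
  rewrite (bigID (fun j : 'I_n => (i < j)%N)) /=; congr (_ + _).
  rewrite (bigD1 i) /= ?ltnn // F0 add0r; apply: eq_bigl => j.
  by rewrite -leqNgt [RHS]ltn_neqAle andbC -val_eqE.
rewrite (eq_bigr _ (fun i _ => split_lt i)) big_split /=.
rewrite (exchange_big_dep predT) //= -big_split big1 // => j _ /=.
by rewrite -big_split big1 // => i _; rewrite /= FN addNr.
Qed.

Section Koszul.
Variables (K : fieldType) (n : nat).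
Local Notation R := {mpoly K[n]}.
Implicit Types (A B : {set 'I_n}) (i j k : 'I_n).

(** The sign by which [e_i] moves to its place in the exterior monomial of
    [i |: A]. *)
Definition ksign i A : R := (-1) ^+ #|[set j in A | (j < i)%N]|.

Lemma ksignU i j A : j \notin A ->
  ksign i (j |: A) = (if (j < i)%N then -1 else 1) * ksign i A.
Proof.
move=> jA; rewrite /ksign; case: ifP => ji; last first.
  rewrite mul1r; congr (_ ^+ #|pred_of_set _|); apply/setP => k; rewrite !inE.
  by case: eqP => // ->; rewrite ji !andbF.
rewrite -exprS (_ : [set k in j |: A | _] = j |: [set k in A | (k < i)%N]).
  by rewrite cardsU1 inE (negPf jA).
by apply/setP => k; rewrite !inE; case: eqP => // ->; rewrite ji.
Qed.

Lemma ksign_swap i j A : i != j -> i \notin A -> j \notin A ->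
  ksign i (j |: A) * ksign j (i |: A) = - (ksign i A * ksign j A).
Proof.
move=> ij iA jA; rewrite !ksignU // mulrACA -[RHS]mulN1r; congr (_ * _).
have: (i : nat) != j by [].
by case: ltngtP => // _ _; rewrite ?mulr1 ?mul1r.
Qed.

Lemma ksignK i A : ksign i A * ksign i A = 1.
Proof. by rewrite /ksign -expr2 sqrr_sign. Qed.

Section Differential.
Variable V : lmodType R.
Local Notation chain := {ffun {set 'I_n} -> V}.
Implicit Types (z w : chain) (S : V -> Prop).

(** The value of a chain at [A] is the coefficient of the exterior monomial of
    the [e_i], [i] in [A]; chains of all degrees share one type, so that the
    differential is an endomorphism. *)
Definition koszul z : chain :=
  [ffun A : {set 'I_n} => \sum_(i | i \notin A) (ksign i A * 'X_i) *: z (i |: A)].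

Lemma koszul_is_linear : linear koszul.
Proof.
move=> c z w; apply/ffunP => A; rewrite !ffunE scaler_sumr -big_split /=.
by apply: eq_bigr => i _; rewrite !ffunE scalerDr !scalerA [c * _]mulrC.
Qed.

HB.instance Definition _ :=
  GRing.isLinear.Build R chain chain _ koszul koszul_is_linear.

Lemma koszulK z : koszul (koszul z) = 0.
Proof.
apply/ffunP => A; rewrite !ffunE.
(* The terms of the double sum, extended by zero to all pairs; they change sign
   with the order in which [i] and [j] are added. *)
pose F i j : V := if [&& i \notin A, j \notin A & i != j] then
  (ksign i A * 'X_i * (ksign j (i |: A) * 'X_j)) *: z (j |: (i |: A)) else 0.
rewrite -[RHS](@sum_antisym _ _ F).
- rewrite big_mkcond; apply: eq_bigr => i _; case: ifPn => iA; last first.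
    by rewrite big1 // => j _; rewrite /F (negPf iA).
  rewrite ffunE scaler_sumr big_mkcond; apply: eq_bigr => j _ /=.
  by rewrite /F iA !inE negb_or eq_sym andbC; case: ifP => //; rewrite scalerA.
- by move=> i; rewrite /F eqxx !andbF.
- move=> i j; rewrite /F andbCA [j == i]eq_sym.
  case: ifPn => [/and3P[jA iA ij]|_]; last by rewrite oppr0.
  rewrite -scaleNr setUCA; congr (_ *: _).
  have sgnE : ksign i A * ksign j (i |: A) = - (ksign j A * ksign i (j |: A)).
    rewrite -[LHS]mulr1 -(ksignK i (j |: A)).
    transitivity (ksign i A * ksign i (j |: A) *
                  (ksign i (j |: A) * ksign j (i |: A))); first by ring.
    rewrite ksign_swap //.
    transitivity (- (ksign i A * ksign i A) * (ksign j A * ksign i (j |: A))).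
      by ring.
    by rewrite ksignK mulN1r.
  by rewrite mulrACA sgnE mulNr ['X_i * 'X_j]mulrC mulrACA.
Qed.

Definition kchain (p : nat) S z :=
  (forall A, S (z A)) /\ (forall A, #|A| != p -> z A = 0).

Definition koszul_exact (p : nat) S :=
  forall z, kchain p S z -> koszul z = 0 ->
  exists2 w, kchain p.+1 S w & koszul w = z.

Lemma kchain_koszul p S z :
  submodule S -> kchain p.+1 S z -> kchain p S (koszul z).
Proof.
move=> HS [Sz z0]; split=> A; rewrite ffunE.
  by apply: submodule_sum => // i _; apply: submoduleZ.
move=> Ap; apply: big1 => i iA; rewrite z0 ?scaler0 //.
by rewrite cardsU1 iA.
Qed.

Lemma kchain_submodule p S : submodule S -> submodule (kchain p S).
Proof.
move=> HS; split.
  by split=> A; rewrite ffunE //; case: HS.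
move=> c z w [Sz z0] [Sw w0]; split=> A; rewrite !ffunE.
  exact: HS.2.
by move=> Ap; rewrite z0 ?w0 ?scaler0 ?addr0.
Qed.

End Differential.

Section MapChain.
Variables (V W : lmodType R) (g : {linear V -> W}).

Definition map_chain (z : {ffun {set 'I_n} -> V}) : {ffun {set 'I_n} -> W} :=
  [ffun A : {set 'I_n} => g (z A)].

Lemma map_chain_is_linear : linear map_chain.
Proof. by move=> c z w; apply/ffunP => A; rewrite !ffunE linearP. Qed.

HB.instance Definition _ :=
  GRing.isLinear.Build R _ _ _ map_chain map_chain_is_linear.

Lemma koszul_map z : koszul (map_chain z) = map_chain (koszul z).
Proof.
apply/ffunP => A; rewrite !ffunE linear_sum; apply: eq_bigr => i _.
by rewrite ffunE linearZ.
Qed.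

End MapChain.
End Koszul.

(** * Exactness of the Koszul complex *)

Section DivVar.
Variables (K : fieldType) (n : nat).
Local Notation R := {mpoly K[n]}.
Implicit Types (f g : R) (i k : 'I_n) (m : 'X_{1..n}).

Lemma mcoeffXM i f m : ('X_i * f)@_m = if (0 < m i)%N then f@_(m - U_(i)) else 0.
Proof.
rewrite mulrC; case: ifPn => [mi|mi].
  have {1}-> : m = (U_(i) + (m - U_(i)))%MM by rewrite addmC submK // lep1mP -lt0n.
  by rewrite mcoeffMX.
apply/eqP; rewrite mcoeff_eq0 (perm_mem (msuppMX _ _)).
by apply: contra mi => /mapP[m' _ ->]; rewrite mnmDE mnm1E eqxx.
Qed.

(** The quotient of the division of [f] by the variable ['X_k]. *)
Definition mdivX k f : R :=
  \sum_(m : 'X_{1..n < msize f}) f@_(m + U_(k)) *: 'X_[m].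

Lemma mcoeff_mdivX k f m : (mdivX k f)@_m = f@_(m + U_(k)).
Proof.
have [lt|le] := ltnP (mdeg m) (msize f); first exact: (mcoeff_mpoly (fun m => f@_(m + U_(k)))).
rewrite [RHS]memN_msupp_eq0; last first.
  by apply: msize_mdeg_ge; rewrite mdegD (leq_trans le) ?leq_addr.
rewrite /mdivX raddf_sum big1 //= => m' _.
rewrite mcoeffZ mcoeffX; case: eqP => [e|_]; last by rewrite mulr0.
by have := bmdeg m'; rewrite e ltnNge le.
Qed.

Lemma mdivX_is_linear k : linear (mdivX k).
Proof.
by move=> c f g; apply/mpolyP => m; rewrite mcoeffD mcoeffZ !mcoeff_mdivX mcoeffD mcoeffZ.
Qed.

HB.instance Definition _ k := GRing.isLinear.Build K R R _ (mdivX k) (mdivX_is_linear k).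

Lemma mdivXK k f : mdivX k ('X_k * f) = f.
Proof.
apply/mpolyP => m; rewrite mcoeff_mdivX mcoeffXM.
by rewrite mnmDE mnm1E eqxx addn1 /= addmK.
Qed.

Lemma mdivXM i k f : i != k -> mdivX k ('X_i * f) = 'X_i * mdivX k f.
Proof.
move=> ik; apply/mpolyP => m; rewrite mcoeff_mdivX !mcoeffXM mnmDE mnm1E.
rewrite eq_sym (negPf ik) addn0; case: ifP => // mi; rewrite mcoeff_mdivX.
congr (_@__); apply/mnmP => j; rewrite !(mnmDE, mnmBE, mnm1E).
by case: (eqVneq i j) => [<-|_]; rewrite ?subn0 // eq_sym (negPf ik) !addn0.
Qed.

Lemma mdivX_sign k i A f : mdivX k (ksign K i A * f) = ksign K i A * mdivX k f.
Proof.
rewrite /ksign -signr_odd !mulr_sign; case: odd => //.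
exact: (raddfN (mdivX k)).
Qed.

(** The remainder, which is [f] with ['X_k] set to zero. *)
Definition mremX k f : R := f - 'X_k * mdivX k f.

Lemma mcoeff_mremX k f m : (mremX k f)@_m = if (0 < m k)%N then 0 else f@_m.
Proof.
rewrite mcoeffB mcoeffXM; case: ifP => mk; last by rewrite subr0.
by rewrite mcoeff_mdivX submK ?subrr // lep1mP -lt0n.
Qed.

End DivVar.

Section AcyclicRing.
Variables (K : fieldType) (n : nat).
Local Notation R := {mpoly K[n]}.
Local Notation chain := {ffun {set 'I_n} -> R^o}.
Implicit Types (A : {set 'I_n}) (i k : 'I_n) (z w : chain).

Definition khomotopy k z : chain :=
  [ffun A : {set 'I_n} =>
     if k \in A then ksign K k (A :\ k) * mdivX k (z (A :\ k)) else 0].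

(** The homotopy of the two-term complex given by ['X_k]: modulo a boundary, a
    cycle may be assumed to vanish at the sets that contain [k] and to have no
    ['X_k] in its other values. *)
Lemma koszul_khomotopy k z : koszul z = 0 ->
  z - koszul (khomotopy k z) =
  [ffun A : {set 'I_n} => if k \in A then 0 else mremX k (z A)].
Proof.
move=> z_cycle; apply/ffunP => A; rewrite !ffunE; case: ifPn => kA; last first.
  rewrite (bigD1 k) //= big1 => [|i /andP[iA ik]]; last first.
    by rewrite ffunE !inE eq_sym (negPf ik) (negPf kA) scaler0.
  rewrite ffunE !inE eqxx /= addr0 setU1K // /mremX; congr (_ - _).
  by rewrite /GRing.scale /= mulrACA ksignK mul1r.
(* At [A = k |: B], the boundary of the homotopy is, up to sign, the quotient by
   ['X_k] of the terms [i != k] of [koszul z] at [B]. As [z] is a cycle, these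
   add up to the opposite of the term of [k], which is ['X_k * z A] up to the
   same sign. *)
pose B := A :\ k; have kB : k \notin B by rewrite !inE eqxx.
have AE : A = k |: B by rewrite setD1K.
have := congr1 (fun w : chain => w B) z_cycle; rewrite !ffunE.
rewrite (bigD1 k) //= -AE => zB.
apply/eqP; rewrite subr_eq0; apply/eqP.
transitivity (ksign K k B * mdivX k (ksign K k B * ('X_k * z A))).
  by rewrite mdivX_sign mulrA ksignK mul1r mdivXK.
have -> : ksign K k B * ('X_k * z A) =
    - \sum_(i | (i \notin B) && (i != k)) ksign K i B * ('X_i * z (i |: B)).
  apply/eqP; rewrite -addr_eq0 mulrA -[X in _ == X]zB; apply/eqP; congr (_ + _).
  by apply: eq_bigr => i _; rewrite mulrA.
rewrite (raddfN (mdivX k)) (raddf_sum (mdivX k)) mulrN mulr_sumr -sumrN.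
apply: eq_big => [i|i /andP[iB ik]].
  by rewrite AE !inE; case: eqP; rewrite ?andbF ?andbT.
rewrite ffunE !inE [k == i]eq_sym (negPf ik) AE !inE eqxx /=.
have -> : (i |: (k |: B)) :\ k = i |: B.
  by rewrite setUCA setU1K // in_setU1 negb_or eq_sym ik kB.
rewrite mdivX_sign mdivXM // /GRing.scale /=.
have e := ksign_swap K ik iB kB.
transitivity (- (ksign K i B * ksign K k B) * ('X_i * mdivX k (z (i |: B)))).
  by ring.
by rewrite -e; ring.
Qed.

Lemma submodule_True (V : lmodType R) : submodule (fun _ : V => True).
Proof. by []. Qed.

Lemma kchain_khomotopy p k z :
  kchain p (fun=> True) z -> kchain p.+1 (fun=> True) (khomotopy k z).
Proof.
move=> [_ z0]; split=> // A Ap; rewrite ffunE; case: ifP => // kA.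
rewrite z0 ?raddf0 ?mulr0 //; apply: contra Ap => /eqP <-.
by rewrite [X in X == _](cardsD1 k) kA.
Qed.

(** Removing the variables one after the other leaves only the constant
    coefficient of the value at the empty set. *)
Lemma koszul_acyclic_ring p z : kchain p (fun=> True) z -> koszul z = 0 ->
  (z set0)@_0%MM = 0 ->
  exists2 w : chain, kchain p.+1 (fun=> True) w & koszul w = z.
Proof.
move=> zp z_cycle z00.
have [w wp [w0 wm]] : exists2 w : chain, kchain p.+1 (fun=> True) w &
    (forall A, has (mem A) (enum 'I_n) -> (z - koszul w) A = 0) /\
    (forall m, ((z - koszul w) set0 : R)@_m
       = if has (fun i => 0 < m i)%N (enum 'I_n) then 0 else (z set0 : R)@_m).
  elim: (enum 'I_n) => [|k s [w wp [w0 wm]]] /=.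
    exists 0; first by apply: (kchain_submodule _ (@submodule_True _)).1.
    by split=> // m; rewrite linear0 subr0.
  set z' := z - koszul w in w0 wm.
  have z'p : kchain p (fun=> True) z'.
    apply: (submoduleB (kchain_submodule _ (@submodule_True _))) => //.
    exact: kchain_koszul.
  have z'_cycle : koszul z' = 0 by rewrite linearB /= koszulK z_cycle subr0.
  exists (w + khomotopy k z').
    apply: (submoduleD (kchain_submodule _ (@submodule_True _))) => //.
    exact: kchain_khomotopy.
  rewrite linearD opprD addrA /= -/z' koszul_khomotopy //; split=> [A|m].
    rewrite ffunE /=; case: (k \in A) => //= /w0 ->.
    by rewrite /mremX (raddf0 (mdivX k)) mulr0 subr0.
  by rewrite ffunE inE mcoeff_mremX wm; case: (0 < m k)%N.
exists w => //; apply/esym/eqP; rewrite -subr_eq0; apply/eqP/ffunP => A.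
rewrite [RHS]ffunE; have [->|[i iA]] := set_0Vmem A; last first.
  by apply: w0; apply/hasP; exists i; rewrite ?mem_enum.
apply/mpolyP => m; rewrite wm mcoeff0; case: ifPn => // /hasPn m0.
suff -> : m = 0%MM by [].
apply/mnmP => i; rewrite mnm0E; apply/eqP; rewrite -leqn0 leqNgt.
by apply: m0; rewrite mem_enum.
Qed.

End AcyclicRing.

Section AcyclicRow.
Variables (K : fieldType) (n r : nat).
Local Notation R := {mpoly K[n]}.

(** Coordinatewise, from the case of the ring. *)
Lemma koszul_acyclic_row p (z : {ffun {set 'I_n} -> 'rV[R]_r}) :
  kchain p (fun=> True) z -> koszul z = 0 ->
  (forall k, (z set0 0 k)@_0%MM = 0) ->
  exists2 w : {ffun {set 'I_n} -> 'rV[R]_r}, kchain p.+1 (fun=> True) w & koszul w = z.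
Proof.
move=> [_ z0] z_cycle z00.
pose zk k : {ffun {set 'I_n} -> R^o} := [ffun A : {set 'I_n} => z A 0 k].
have /fin_all_exists[w Hw] : forall k, exists w : {ffun {set 'I_n} -> R^o},
    kchain p.+1 (fun=> True) w /\ koszul w = zk k.
  move=> k; have [|||w wp wz] := @koszul_acyclic_ring K n p (zk k); last by exists w.
  - by split=> // A Ap; rewrite ffunE z0 ?mxE.
  - apply/ffunP => A.
    have := congr1 (fun y : {ffun {set 'I_n} -> 'rV[R]_r} => y A 0 k) z_cycle.
    rewrite !ffunE summxE mxE => e; rewrite -[RHS]e; apply: eq_bigr => i _.
    by rewrite mxE ffunE.
  - by rewrite ffunE.
exists [ffun A : {set 'I_n} => \row_k w k A].
  split=> // A Ap; rewrite ffunE; apply/rowP => k; rewrite !mxE.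
  by have [[_ ->]] := Hw k.
apply/ffunP => A; rewrite ffunE; apply/rowP => k; rewrite summxE.
have [_ /(congr1 (fun y : {ffun {set 'I_n} -> R^o} => y A))] := Hw k.
rewrite !ffunE => <-; apply: eq_bigr => i _.
by rewrite mxE ffunE mxE.
Qed.

End AcyclicRow.

Section AcyclicProjective.
Import freeg.
Variables (K : fieldType) (n : nat).
Local Notation R := {mpoly K[n]}.

Section FreeLift.
Variables (M : lmodType R) (X : choiceType) (f : X -> M).

HB.instance Definition _ :=
  GRing.isAdditive.Build {freeg X / R} M (fglift f) (lift_is_additive f).

Lemma fglift_is_scalable : scalable (fglift f).
Proof.
move=> c u; rewrite -(freeg_sumE u) scaler_sumr.
rewrite !raddf_sum.
apply: eq_bigr => x _ /=; rewrite liftU scalerA -[RHS]liftU; congr (fglift _ _).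
by apply/eqP/freeg_eqP => y; rewrite coeffZ !coeffU mulrA.
Qed.

HB.instance Definition _ :=
  GRing.isScalable.Build R {freeg X / R} M _ (fglift f) fglift_is_scalable.

End FreeLift.

(** Coordinatewise too: a chain has only finitely many values, and so involves
    only finitely many basis elements. *)
Lemma koszul_acyclic_free (X : choiceType) p :
  koszul_exact (V := {freeg X / R}) p.+1 (fun=> True).
Proof.
move=> z [_ z0] z_cycle.
pose zx x : {ffun {set 'I_n} -> R^o} := [ffun A : {set 'I_n} => coeff x (z A)].
have H x : exists w : {ffun {set 'I_n} -> R^o},
    kchain p.+2 (fun=> True) w /\ koszul w = zx x.
  have [|||w wp wz] := @koszul_acyclic_ring K n p.+1 (zx x); last by exists w.
  - by split=> // A Ap; rewrite ffunE z0 ?coeff0.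
  - apply/ffunP => A.
    have := congr1 (fun y : {ffun {set 'I_n} -> {freeg X / R}} => coeff x (y A)) z_cycle.
    rewrite !ffunE raddf_sum coeff0 => e; rewrite -[RHS]e; apply: eq_bigr => i _.
    by rewrite ffunE /= coeffZ.
  - by rewrite ffunE z0 ?cards0 // coeff0 mcoeff0.
pose w x := proj1_sig (constructive_indefinite_description _ (H x)).
have Hw x : kchain p.+2 (fun=> True) (w x) /\ koszul (w x) = zx x.
  by rewrite /w; case: constructive_indefinite_description.
pose D := undup (flatten [seq dom (z A) | A : {set 'I_n}]).
exists [ffun A : {set 'I_n} => \sum_(x <- D) << w x A *g x >>].
  split=> // A Ap; rewrite ffunE big1 // => x _.
  by have [[_ ->] // _] := Hw x; rewrite freegU0.
apply/ffunP => A; apply/eqP/freeg_eqP => y.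
rewrite !ffunE raddf_sum /=.
have sum_coeff B : coeff y (\sum_(x <- D) << w x B *g x >>) =
    if y \in D then w y B else 0.
  rewrite raddf_sum /=; case: ifPn => yD.
    rewrite (bigD1_seq y) ?undup_uniq //= coeffU eqxx mulr1 big1 ?addr0 // => x xy.
    by rewrite coeffU (negPf xy) mulr0.
  rewrite big_seq big1 // => x xD; rewrite coeffU.
  by case: eqP xD yD => [->->|]; rewrite ?mulr0.
transitivity (\sum_(i | i \notin A) (ksign K i A * 'X_i) *
    (if y \in D then w y (i |: A) else 0)).
  by apply: eq_bigr => i _; rewrite ffunE coeffZ sum_coeff.
case: (boolP (y \in D)) => yD.
  have [_ /(congr1 (fun y : {ffun {set 'I_n} -> R^o} => y A))] := Hw y.
  by rewrite !ffunE.
rewrite big1 => [|i _]; last by rewrite mulr0.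
apply/esym/coeff_outdom; apply: contra yD => yA.
rewrite mem_undup; apply/flattenP; exists (dom (z A)) => //.
exact: image_f.
Qed.

(** A projective module is a direct summand of the free module on its
    elements, and a direct summand of an exact complex is exact. *)
Lemma koszul_acyclic_projective (P : lmodType R) p :
  projective_module P -> koszul_exact p.+1 (fun _ : P => True).
Proof.
move=> projP z [_ z0] z_cycle.
pose pi : {linear {freeg P / R} -> P} := fglift (idfun : P -> P).
have [|s Hs] := projP _ _ pi idfun.
  by move=> y; exists << y >>; rewrite /= liftU scale1r.
have [||w [_ w0] wz] := @koszul_acyclic_free P p (map_chain s z).
- by split=> // A Ap; rewrite ffunE z0 ?linear0.
- by rewrite koszul_map z_cycle linear0.
exists (map_chain pi w); first by split=> // A Ap; rewrite ffunE w0 ?linear0.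
by rewrite koszul_map wz; apply/ffunP => A; rewrite !ffunE Hs.
Qed.

End AcyclicProjective.

(** * Homogeneous components *)

Section Grading.
Variables (K : fieldType) (n : nat).
Local Notation R := {mpoly K[n]}.
Implicit Types (f g : R) (s t : int).

(** Indexed by all integers, so that degrees can be shifted freely. *)
Definition hcomp t f : R :=
  if t is Posz k then pihomog mdeg k f else 0.

Lemma mcoeff_hcomp t f m : (hcomp t f)@_m = if t == mdeg m then f@_m else 0.
Proof.
case: t => [k|k] /=; last by rewrite mcoeff0.
pose E m := if mdeg m == k then f@_m else 0.
rewrite (@pihomogwE _ _ _ k (maxn (msize f) (mdeg m).+1)) ?leq_maxl //.
rewrite big_mkcond /= (eq_bigr (fun m' : 'X_{1..n < _} => E m' *: 'X_[m'])); last first.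
  by move=> m' _; rewrite /E; case: ifP => _; rewrite ?scale0r.
by rewrite mcoeff_mpoly ?leq_maxr // /E eq_sym.
Qed.

Lemma hcomp_is_additive t : additive (hcomp t).
Proof.
move=> f g; apply/mpolyP => m; rewrite mcoeffB !mcoeff_hcomp mcoeffB.
by case: ifP => // _; rewrite subr0.
Qed.

HB.instance Definition _ t := GRing.isAdditive.Build R R (hcomp t) (hcomp_is_additive t).

Lemma homogZP t f : homogZ t f <-> hcomp t f = f.
Proof.
case: t => k /=; last by split=> ->.
by rewrite homog_piE; split=> [/eqP|->].
Qed.

Lemma hcompK t f : hcomp t (hcomp t f) = hcomp t f.
Proof. by apply/mpolyP => m; rewrite !mcoeff_hcomp; case: (t == mdeg m). Qed.

Lemma hcompM s t f g : homogZ s g -> hcomp t (f * g) = hcomp (t - s) f * g.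
Proof.
move=> /homogZP gs; apply/mpolyP => m; rewrite mcoeff_hcomp !mcoeffM.
rewrite -[LHS](_ : \sum_(k : 'X_{1..n < (mdeg m).+1, (mdeg m).+1} | m == (k.1 + k.2)%MM)
  (if t == mdeg m then f@_k.1 * g@_k.2 else 0) = _); last first.
  by case: (t == mdeg m) => //; rewrite big1.
apply: eq_bigr => -[k1 k2] /= /eqP mE; rewrite mcoeff_hcomp.
have := congr1 (mcoeff k2) gs; rewrite mcoeff_hcomp.
case: eqP => [-> _|_ <-]; last by rewrite !mulr0; case: ifP.
rewrite {1}mE mdegD PoszD subr_eq; case: ifP => // _; by rewrite mul0r.
Qed.

Section Rows.
Variables (r : nat) (delta : 'I_r -> int).

(** Homogeneous components of row vectors, for the grading in which the [k]-th
    basis vector has degree [delta k]. *)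
Definition rcomp t (u : 'rV[R]_r) : 'rV[R]_r :=
  \row_k hcomp (t - delta k) (u 0 k).

Lemma rcomp_is_additive t : additive (rcomp t).
Proof. by move=> u v; apply/rowP => k; rewrite !mxE raddfB. Qed.

HB.instance Definition _ t :=
  GRing.isAdditive.Build 'rV[R]_r 'rV[R]_r (rcomp t) (rcomp_is_additive t).

Lemma rcompK t u : rcomp t (rcomp t u) = rcomp t u.
Proof. by apply/rowP => k; rewrite !mxE hcompK. Qed.

Lemma rcomp_mul r' (eps : 'I_r' -> int) (B : 'M[R]_(r, r')) :
  (forall i k, homogZ (delta i - eps k) (B i k)) -> forall t u,
  \row_k hcomp (t - eps k) ((u *m B) 0 k) = rcomp t u *m B.
Proof.
move=> HB t u; apply/rowP => k; rewrite !mxE raddf_sum; apply: eq_bigr => i _.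
rewrite /= (hcompM _ _ (HB i k)) mxE; congr (hcomp _ _ * _).
by rewrite opprB addrA subrK.
Qed.

End Rows.

(** A family of projections that behaves as the homogeneous components of a
    graded module. The constant family of identities is one of them, which
    makes every statement about graded modules one about modules. *)
Record grading (V : lmodType R) := Grading {
  gcomp :> int -> V -> V;
  gcompB : forall t, additive (gcomp t);
  gcompK : forall t v, gcomp t (gcomp t v) = gcomp t v;
  gcompZ : forall s t f v, homogZ s f -> gcomp t (f *: v) = f *: gcomp (t - s) v
}.

HB.instance Definition _ (V : lmodType R) (c : grading V) t :=
  GRing.isAdditive.Build V V (c t) (gcompB c t).

Lemma hcompZ s t f (v : R^o) : homogZ s f -> hcomp t (f *: v) = f *: (hcomp (t - s) v : R^o).
Proof. by move=> fs; rewrite /GRing.scale /= mulrC (hcompM _ _ fs) mulrC. Qed.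

Definition ring_grading : grading R^o := @Grading R^o hcomp hcomp_is_additive hcompK hcompZ.

Lemma rcompZ r (delta : 'I_r -> int) s t f v :
  homogZ s f -> rcomp delta t (f *: v) = f *: rcomp delta (t - s) v.
Proof.
by move=> fs; apply/rowP => k; rewrite !mxE mulrC (hcompM _ _ fs) mulrC addrAC.
Qed.

Definition row_grading r (delta : 'I_r -> int) : grading 'rV[R]_r :=
  @Grading 'rV[R]_r (rcomp delta) (rcomp_is_additive delta) (rcompK delta)
    (@rcompZ r delta).

Definition trivial_grading (V : lmodType R) : grading V.
Proof. by exists (fun _ v => v). Defined.


(** * Koszul homology in a given degree *)

(** Vanishing, in internal degree [t], of the [p]-th Koszul homology of the
    submodule [S]. The [e_i] have degree 1, whence the degree [t - p] of the
    values of a cycle. The chain [w] may be arbitrary, since one of its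
    homogeneous components bounds [z] as well. *)
Definition koszul_vanish (V : lmodType R) (c : grading V) (p : nat) t (S : V -> Prop) :=
  forall z : {ffun {set 'I_n} -> V}, kchain p S z -> koszul z = 0 ->
  (forall A, c (t - p%:Z) (z A) = z A) ->
  exists2 w, kchain p.+1 S w & koszul w = z.

Lemma koszul_vanish_ext (V : lmodType R) (c : grading V) p t (S S' : V -> Prop) :
  (forall v, S v <-> S' v) -> koszul_vanish c p t S <-> koszul_vanish c p t S'.
Proof.
have aux (S1 S2 : V -> Prop) : (forall v, S1 v <-> S2 v) ->
    koszul_vanish c p t S1 -> koszul_vanish c p t S2.
  move=> SS H z [Sz z0] zc zt; have [|w [Sw w0] wz] := H z _ zc zt.
    by split=> // A; apply/SS.
  by exists w => //; split=> // A; apply/SS.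
by move=> SS; split; apply: aux => // v; rewrite SS.
Qed.

Lemma homogZ_ksign (i : 'I_n) A : homogZ 1 (ksign K i A * 'X_i).
Proof.
rewrite /= /ksign -signr_odd mulr_sign; case: odd; last first.
  by rewrite dhomogX /= mdeg1.
by rewrite rpredN dhomogX /= mdeg1.
Qed.

Lemma koszul_comp (V : lmodType R) (c : grading V) t (z : {ffun {set 'I_n} -> V}) :
  koszul [ffun A : {set 'I_n} => c t (z A)] =
  [ffun A : {set 'I_n} => c (t + 1) (koszul z A)].
Proof.
apply/ffunP => A; rewrite !ffunE raddf_sum; apply: eq_bigr => i _ /=.
by rewrite (gcompZ _ _ _ (homogZ_ksign i A)) addrK ffunE.
Qed.

Lemma kchain_comp (V : lmodType R) (c : grading V) p t (z : {ffun {set 'I_n} -> V}) :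
  kchain p (fun=> True) z ->
  kchain p (fun=> True) [ffun A : {set 'I_n} => c t (z A)].
Proof. by move=> [_ z0]; split=> // A Ap; rewrite ffunE z0 ?raddf0. Qed.

Section DimensionShift.
Variables (V W : lmodType R) (cV : grading V) (cW : grading W) (g : {linear W -> V}).
Hypothesis g_graded : forall t w, g (cW t w) = cV t (g w).
Hypothesis W_acyclic : forall p, koszul_exact p.+1 (fun _ : W => True).
Variables (SV : V -> Prop) (SW : W -> Prop).
Hypothesis SVE : forall v, SV v <-> exists w, g w = v.
Hypothesis SWE : forall w, SW w <-> g w = 0.
Local Notation chain U := {ffun {set 'I_n} -> U}.

Lemma kchain_lift p (z : chain V) : kchain p SV z ->
  exists2 w : chain W, kchain p (fun=> True) w & map_chain g w = z.
Proof.
move=> [Sz z0].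
have /fin_all_exists[w Hw] : forall A, exists w, g w = z A /\ (#|A| != p -> w = 0).
  move=> A; have [w gw] := (SVE _).1 (Sz A).
  case: (eqVneq #|A| p) => Ap; first by exists w.
  by exists 0; rewrite linear0 z0.
exists [ffun A : {set 'I_n} => w A].
  by split=> // A; rewrite ffunE; case: (Hw A).
by apply/ffunP => A; rewrite !ffunE; case: (Hw A).
Qed.

Lemma kchain_image p (w : chain W) :
  kchain p (fun=> True) w -> kchain p SV (map_chain g w).
Proof.
move=> [_ w0]; split=> A; rewrite ffunE; first by apply/SVE; exists (w A).
by move=> Ap; rewrite w0 ?linear0.
Qed.

Lemma kchain_kernel p (w : chain W) :
  kchain p (fun=> True) w -> map_chain g w = 0 -> kchain p SW w.
Proof.
move=> [_ w0] gw; split=> // A; apply/SWE.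
by have := congr1 (fun z : chain V => z A) gw; rewrite !ffunE.
Qed.

(** The connecting map of the sequence 0 -> [SW] -> [W] -> [SV] -> 0 is
    injective, by the exactness of the Koszul complex of [W] in degree [p.+1]. *)
Lemma koszul_vanish_image p t :
  koszul_vanish cW p t SW -> koszul_vanish cV p.+1 t SV.
Proof.
move=> vanW z zp zc zt.
have [w0 w0p gw0] := kchain_lift zp.
pose w : chain W := [ffun A : {set 'I_n} => cW (t - p.+1%:Z) (w0 A)].
have wp : kchain p.+1 (fun=> True) w by apply: kchain_comp.
have gw : map_chain g w = z.
  apply/ffunP => A; rewrite !ffunE g_graded -[RHS]zt; congr (cV _ _).
  by rewrite -gw0 ffunE.
have dwp : kchain p SW (koszul w).
  apply: kchain_kernel; first exact: kchain_koszul.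
  by rewrite -koszul_map gw.
have [||v [Sv v0] vw] := vanW _ dwp; first exact: koszulK.
  move=> A; rewrite koszul_comp ffunE (_ : t - p%:Z = t - p.+1%:Z + 1) ?gcompK //.
  by rewrite -addn1 PoszD opprD addrA subrK.
have [||y yp yw] := @W_acyclic p (w - v).
- by apply: submoduleB => //; first exact: kchain_submodule.
- by rewrite linearB /= vw subrr.
exists (map_chain g y); first exact: kchain_image.
rewrite koszul_map yw linearB /= gw; apply/ffunP => A; rewrite !ffunE.
by rewrite (SWE _).1 ?subr0.
Qed.

(** The connecting map is surjective, by the exactness of the Koszul complex of
    [W] in degree [p]. In degree zero the complex of [W] is not exact, and the
    hypothesis on [SW], which holds for the syzygies of a minimal resolution,
    makes up for it. *)
Lemma koszul_vanish_kernel p t :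
  (forall z : chain W, kchain 0 SW z ->
    exists2 w : chain W, kchain 1 (fun=> True) w & koszul w = z) ->
  koszul_vanish cV p.+1 t SV -> koszul_vanish cW p t SW.
Proof.
move=> W_acyclic0 vanV z zp zc zt.
have [w0 w0p w0z] : exists2 w : chain W, kchain p.+1 (fun=> True) w & koszul w = z.
  case: p zp {zt vanV} => [|p] zp; first exact: W_acyclic0.
  by apply: W_acyclic => //; split=> //; case: zp.
pose w : chain W := [ffun A : {set 'I_n} => cW (t - p.+1%:Z) (w0 A)].
have wp : kchain p.+1 (fun=> True) w by apply: kchain_comp.
have wz : koszul w = z.
  rewrite koszul_comp w0z; apply/ffunP => A; rewrite ffunE -[RHS]zt.
  by congr (cW _ _); rewrite -addn1 PoszD opprD addrA subrK.
have gz : map_chain g z = 0.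
  by apply/ffunP => A; rewrite !ffunE; apply/SWE; case: zp.
have [|||y yp yw] := vanV (map_chain g w); first exact: kchain_image.
- by rewrite koszul_map wz gz.
- by move=> A; rewrite !ffunE -g_graded gcompK.
have [y' y'p gy'] := kchain_lift yp.
exists (w - koszul y'); last by rewrite linearB /= koszulK subr0.
apply: kchain_kernel; last by rewrite linearB /= -koszul_map gy' yw subrr.
apply: (submoduleB (kchain_submodule _ (@submodule_True _ _ _))) => //.
exact: kchain_koszul.
Qed.

End DimensionShift.

Lemma koszul_kchain0 (V : lmodType R) (z : {ffun {set 'I_n} -> V}) :
  (forall A, A != set0 -> z A = 0) -> koszul z = 0.
Proof.
move=> z0; apply/ffunP => A; rewrite !ffunE big1 // => i _.
by rewrite z0 ?scaler0 //; apply/set0Pn; exists i; rewrite setU11.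
Qed.

(** The Koszul homology in degree zero is the quotient by the multiple by
    (x_1, ..., x_n). When the kernel of [g] lies in the multiple of the free
    module by this ideal, the images of the basis vectors are a basis of the
    quotient. *)
Lemma koszul_vanish_basis (V : lmodType R) (cV : grading V) r
    (delta : 'I_r -> int) (g : {linear 'rV[R]_r -> V}) (SV : V -> Prop) t :
  (forall t u, g (rcomp delta t u) = cV t (g u)) ->
  (forall v, SV v <-> exists u, g u = v) ->
  (forall u, g u = 0 -> forall k, (u 0 k)@_0%MM = 0) ->
  koszul_vanish cV 0 t SV <-> forall k, delta k != t.
Proof.
move=> g_graded SVE g_min; split=> [van k|delta_t z [Sz z0] _ zt].
  apply/eqP => dk.
  (* Otherwise the image of the [k]-th basis vector would be a boundary, and
     the vector itself congruent to 0 modulo the variables. *)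
  pose z : {ffun {set 'I_n} -> V} :=
    [ffun A : {set 'I_n} => if A == set0 then g (delta_mx 0 k) else 0].
  have [|||w [Sw _] wz] := van z.
  - split=> A; rewrite ffunE.
      case: ifP => _; apply/SVE; first by exists (delta_mx 0 k).
      by exists 0; rewrite linear0.
    by rewrite -cards_eq0 => /negPf->.
  - by apply: koszul_kchain0 => A; rewrite ffunE => /negPf->.
  - move=> A; rewrite ffunE; case: ifP => _; last by rewrite raddf0.
    rewrite subr0 -g_graded; congr (g _); apply/rowP => j; rewrite !mxE eqxx /=.
    apply/mpolyP => m; rewrite mcoeff_hcomp; case: (eqVneq j k) => [->|] /=.
      by rewrite dk subrr mcoeff1 -mdeg_eq0 eq_sym; case: (mdeg m).
    by rewrite mcoeff0 if_same.
  have /fin_all_exists[u Hu] : forall i : 'I_n, exists u, g u = w (i |: set0).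
    by move=> i; apply/SVE.
  have := congr1 (fun y : {ffun {set 'I_n} -> V} => y set0) wz; rewrite !ffunE eqxx => gk.
  pose v := \sum_(i | i \notin set0) (ksign K i set0 * 'X_i) *: u i.
  have /g_min/(_ k) : g (v - delta_mx 0 k) = 0.
    rewrite linearB /= -gk /v linear_sum -sumrB big1 // => i _.
    by rewrite linearZ /= Hu subrr.
  rewrite !mxE !eqxx /= mcoeffB mcoeff1 eqxx summxE raddf_sum big1 => [|i _].
    by move/eqP; rewrite sub0r oppr_eq0 oner_eq0.
  by rewrite mxE [ksign _ _ _ * _]mulrC -mulrA /= mcoeffXM mnm0E.
(* A preimage of degree [t] has no coordinate of degree 0, hence no constant
   coefficient, and is itself a boundary. *)
have [u0 gu0] := (SVE _).1 (Sz set0).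
pose u := rcomp delta t u0.
have gu : g u = z set0 by rewrite /u g_graded gu0 -[RHS]zt subr0.
pose zu : {ffun {set 'I_n} -> 'rV[R]_r} :=
  [ffun A : {set 'I_n} => if A == set0 then u else 0].
have [|||w [_ w0] wzu] := @koszul_acyclic_row K n r 0 zu.
- by split=> // A; rewrite ffunE -cards_eq0 => /negPf->.
- by apply: koszul_kchain0 => A; rewrite ffunE => /negPf->.
- move=> k; rewrite ffunE eqxx mxE mcoeff_hcomp mdeg0 subr_eq add0r eq_sym.
  by rewrite (negPf (delta_t k)).
exists (map_chain g w).
  split=> A; rewrite ffunE; first by apply/SVE; exists (w A).
  by move=> Ap; rewrite w0 ?linear0.
rewrite koszul_map wzu; apply/ffunP => A; rewrite !ffunE.
case: ifP => [/eqP->//|A0]; rewrite linear0 z0 //.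
by rewrite cards_eq0 A0.
Qed.

End Grading.

(** * Minimal resolutions and Koszul homology *)

Section Betti.
Variables (K : fieldType) (n : nat).
Local Notation R := {mpoly K[n]}.

Section RowValue.
Variables (r : nat) (a : 'cV[R]_r).

Definition row_value (u : 'rV[R]_r) : R^o := (u *m a) 0 0.

Lemma row_value_is_linear : linear row_value.
Proof. by move=> c u v; rewrite /row_value mulmxDl -scalemxAl !mxE. Qed.

HB.instance Definition _ :=
  GRing.isLinear.Build R 'rV[R]_r R^o _ row_value row_value_is_linear.

Lemma row_value_eq0 u : row_value u = 0 <-> u *m a = 0.
Proof.
split=> [u0|]; last by rewrite /row_value => ->; rewrite mxE.
by apply/matrixP => i j; rewrite !ord1 [LHS]u0 mxE.
Qed.

End RowValue.

Lemma koszul_exact_row r p : koszul_exact p.+1 (fun _ : 'rV[R]_r => True).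
Proof.
move=> z zp zc; apply: koszul_acyclic_row => // k.
by case: zp => _ ->; rewrite ?cards0 // mxE mcoeff0.
Qed.

Lemma kchain0_row r (S : 'rV[R]_r -> Prop) z :
  (forall u, S u -> forall k, (u 0 k)@_0%MM = 0) ->
  kchain 0 S z ->
  exists2 w : {ffun {set 'I_n} -> 'rV[R]_r}, kchain 1 (fun=> True) w & koszul w = z.
Proof.
move=> S0 [Sz z0]; apply: koszul_acyclic_row => //; last by move=> k; apply: S0.
by apply: koszul_kchain0 => A; rewrite -cards_eq0 => /z0.
Qed.

Lemma min_coeff0 r s (D : 'M[R]_(r, s)) v k :
  (forall i k, (D i k)@_0%MM = 0) -> ((v *m D : 'rV_s) 0 k)@_0%MM = 0.
Proof.
move=> D0; rewrite mxE raddf_sum big1 // => i _ /=.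
by rewrite rmorphM /= D0 mulr0.
Qed.

Variables (I : R -> Prop) (F : graded_free_complex K n).
Hypothesis F_min : is_minimal_resolution I F.

Let aug_exact u : row_value (gf_aug F) u = 0 <-> exists v, u = v *m gf_diff F 0.
Proof. by case: F_min => -[_ H _] _; rewrite row_value_eq0. Qed.

Let diff_exact j (u : 'rV_(gf_rank F j.+1)) :
  u *m gf_diff F j = 0 <-> exists v, u = v *m gf_diff F j.+1.
Proof. by case: F_min => -[_ _ H] _. Qed.

Let diff_min j i k : (gf_diff F j i k)@_0%MM = 0.
Proof. by case: F_min. Qed.

Let aug_image f : I f <-> exists u, row_value (gf_aug F) u = f.
Proof. by case: F_min => -[]. Qed.

Let aug_graded t u : row_value (gf_aug F) (rcomp (@gf_deg _ _ F 0%N) t u) =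
  ring_grading K n t (row_value (gf_aug F) u).
Proof.
rewrite /row_value -(@rcomp_mul _ _ _ _ _ (fun=> 0)) => [|i k].
  by rewrite mxE subr0.
by rewrite subr0 ord1; apply: gf_aug_homog.
Qed.

Let diff_graded j t (u : 'rV_(gf_rank F j.+1)) :
  rcomp (@gf_deg _ _ F j.+1) t u *m gf_diff F j =
  rcomp (@gf_deg _ _ F j) t (u *m gf_diff F j).
Proof. by rewrite -(rcomp_mul (@gf_diff_homog _ _ F j)). Qed.

Let diff_image j (u : 'rV_(gf_rank F j)) := exists v, u = v *m gf_diff F j.

(** Dimension shifting: homology moves down by one degree at each syzygy
    module. *)
Lemma koszul_vanish_syzygy p t j :
  koszul_vanish (ring_grading K n) (p + j).+1 t I <->
  koszul_vanish (row_grading K n (@gf_deg _ _ F j)) p t (@diff_image j).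
Proof.
elim: j p => [|j IH] p.
  rewrite addn0; split.
    apply: (@koszul_vanish_kernel _ _ _ _ _ _ (row_value (gf_aug F))) => //.
    - by move=> q; apply: koszul_exact_row.
    - by move=> u; rewrite aug_exact.
    - by move=> z; apply: kchain0_row => u [v ->] k; apply: min_coeff0.
  apply: (@koszul_vanish_image _ _ _ _ _ _ (row_value (gf_aug F))) => //.
  - by move=> q; apply: koszul_exact_row.
  - by move=> u; rewrite aug_exact.
rewrite addnS -addSn IH; split.
  apply: (@koszul_vanish_kernel _ _ _ _ _ _ (mulmxr (gf_diff F j))).
  - by move=> s u; apply: diff_graded.
  - by move=> q; apply: koszul_exact_row.
  - by move=> u; split=> -[v]; exists v.
  - by move=> u; rewrite /= diff_exact.
  - by move=> z; apply: kchain0_row => u [v ->] k; apply: min_coeff0.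
apply: (@koszul_vanish_image _ _ _ _ _ _ (mulmxr (gf_diff F j))).
- by move=> s u; apply: diff_graded.
- by move=> q; apply: koszul_exact_row.
- by move=> u; split=> -[v]; exists v.
- by move=> u; rewrite /= diff_exact.
Qed.

(** The [j]-th Koszul homology of [I] is the space of minimal generators of the
    [j]-th syzygy module, and the basis of [F_j] maps to a basis of it. *)
Theorem koszul_vanish_betti j t :
  koszul_vanish (ring_grading K n) j t I <-> forall k, @gf_deg _ _ F j k != t.
Proof.
case: j => [|j].
  apply: (@koszul_vanish_basis _ _ _ _ _ _ (row_value (gf_aug F))) => //.
  by move=> u /aug_exact[v ->] k; apply: min_coeff0.
rewrite -(add0n j) koszul_vanish_syzygy.
apply: (@koszul_vanish_basis _ _ _ _ _ _ (mulmxr (gf_diff F j))).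
- by move=> s u; apply: diff_graded.
- by move=> u; split=> -[v]; exists v.
- by move=> u /diff_exact[v ->] k; apply: min_coeff0.
Qed.

(** Without [F_j], all basis vectors of [F_j.+1] are cycles, and these have no
    constant coefficients. *)
Lemma gf_rank_eq0 j : gf_rank F j = 0%N -> gf_rank F j.+1 = 0%N.
Proof.
move=> Fj0; case E : (gf_rank F j.+1) => [//|r].
have k : 'I_(gf_rank F j.+1) by rewrite E; exact: ord0.
have : (delta_mx 0 k : 'rV[R]_(gf_rank F j.+1)) *m gf_diff F j = 0.
  by apply/rowP => i; have := ltn_ord i; rewrite {2}Fj0.
move=> /diff_exact[v /(congr1 (fun u : 'rV_ _ => (u 0 k)@_0%MM))].
rewrite min_coeff0 // mxE !eqxx mcoeff1 eqxx => /eqP.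
by rewrite oner_eq0.
Qed.

End Betti.

(** * Projective dimension *)

Section ProjDim.
Variables (K : fieldType) (n : nat).
Local Notation R := {mpoly K[n]}.

Lemma koszul_exact_vanish (V : lmodType R) p (S : V -> Prop) :
  koszul_exact p S <-> koszul_vanish (trivial_grading V) p 0 S.
Proof.
split=> H z zp zc; first by move=> _; apply: H.
exact: H.
Qed.

(** Dimension shifting along a projective resolution ends, after [q.+1] steps,
    in a zero module. *)
Lemma pd_le_koszul_exact (V : lmodType R) (S : V -> Prop) q p :
  pd_le S q -> (q < p)%N -> koszul_exact p S.
Proof.
move=> [P [delta [eps [projP P0 epsE eps_exact delta_exact]]]] /subnK <-.
rewrite addnS; move: (p - q.+1)%N => {}p.
have acyclic j s : koszul_exact s.+1 (fun _ : P j => True).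
  exact: koszul_acyclic_projective.
have exact_im d j : (j + d)%N = q -> koszul_exact (p + d) (fun x => exists z, delta j z = x).
  elim: d j => [|d IH] j.
    rewrite addn0 => -> z [Sz _] _; exists 0.
      split=> A; rewrite ffunE //; exists 0; exact: linear0.
    rewrite linear0; apply/ffunP => A; rewrite ffunE.
    by have [y <-] := Sz A; rewrite (P0 _ _ y) ?linear0.
  rewrite addnS -addSn => /IH H; rewrite addnS; apply/koszul_exact_vanish.
  have {}H := (koszul_exact_vanish _ _).1 H.
  apply: (@koszul_vanish_image _ _ _ _ _ (trivial_grading _) (delta j)) H => //.
  by move=> w; rewrite delta_exact.
apply/koszul_exact_vanish.
have H := (koszul_exact_vanish _ _).1 (exact_im q 0%N (erefl _)).
apply: (@koszul_vanish_image _ _ _ _ _ (trivial_grading _) eps) H => //.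
by move=> w; rewrite eps_exact.
Qed.

Lemma projective_row r : projective_module 'rV[R]_r.
Proof.
move=> M N g f gsurj.
have /fin_all_exists[x Hx] : forall k : 'I_r, exists x, g x = f (delta_mx 0 k).
  by move=> k; apply: gsurj.
pose h (u : 'rV[R]_r) : M := \sum_k u 0 k *: x k.
have h_linear : linear h.
  move=> c u v; rewrite /h scaler_sumr -big_split; apply: eq_bigr => k _ /=.
  by rewrite !mxE scalerDl scalerA.
pose hl : {linear 'rV[R]_r -> M} :=
  HB.pack h (GRing.isLinear.Build R 'rV[R]_r M _ h h_linear).
exists hl => u /=.
rewrite /h linear_sum [in RHS](row_sum_delta u) linear_sum; apply: eq_bigr => k _.
by rewrite !linearZ /= Hx.
Qed.

(** A shorter projective resolution would make the [p]-th Koszul homology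
    vanish, and with it the basis of [F_p]. *)
Lemma is_pd_ideal_minimal (I : R -> Prop) (F : graded_free_complex K n) p :
  is_minimal_resolution I F -> gf_rank F p != 0%N ->
  (forall j, (p < j)%N -> gf_rank F j = 0%N) -> is_pd_ideal I p.
Proof.
move=> F_min Fp F0; split=> [|q pdq].
  have [[augI aug_exact diff_exact] _] := F_min.
  exists (fun j => 'rV[R]_(gf_rank F j)), (fun j => mulmxr (gf_diff F j)),
    (row_value (gf_aug F)).
  split=> [j|j pj x|f|u|j u].
  - exact: projective_row.
  - by apply/rowP => k; have := ltn_ord k; rewrite {2}F0.
  - exact: augI.
  - by rewrite row_value_eq0 aug_exact; split=> -[v]; exists v.
  - by rewrite /= diff_exact; split=> -[v]; exists v.
rewrite leqNgt; apply/negP => /(pd_le_koszul_exact pdq) H.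
have k : 'I_(gf_rank F p) by apply: (@Ordinal _ 0); rewrite lt0n.
have [+ _] := koszul_vanish_betti F_min p (gf_deg k).
by move=> /(_ (fun z zp zc _ => H z zp zc) k); rewrite eqxx.
Qed.

End ProjDim.

(** * Existence of minimal resolutions *)

Section MinimalGenerators.
Variables (K : fieldType) (n : nat).
Local Notation R := {mpoly K[n]}.

Record generators (r : nat) := Generators {
  gen_rank : nat;
  gen_deg : 'I_gen_rank -> int;
  gen_mx : 'M[R]_(gen_rank, r)
}.

Definition homog_generators r (delta : 'I_r -> int) (U : 'rV[R]_r -> Prop)
    (G : generators r) :=
  (forall i k, homogZ (gen_deg i - delta k) (gen_mx G i k)) /\
  (forall u, U u <-> exists v, u = v *m gen_mx G).

Definition min_generators r (G : generators r) :=
  forall v : 'rV_(gen_rank G), v *m gen_mx G = 0 -> forall k, (v 0 k)@_0%MM = 0.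

Lemma rcomp_sum r (delta : 'I_r -> int) (u : 'rV[R]_r) :
  exists s : seq int, u = \sum_(t <- s) rcomp delta t u.
Proof.
exists (undup [seq delta k + (mdeg m)%:Z | k <- enum 'I_r, m <- msupp (u 0 k)]).
apply/rowP => k; apply/mpolyP => m; rewrite summxE raddf_sum /=.
have [m0|m0] := eqVneq (u 0 k)@_m 0.
  by rewrite m0 big1 // => t _; rewrite mxE mcoeff_hcomp m0 if_same.
rewrite (bigD1_seq (delta k + (mdeg m)%:Z)) ?undup_uniq //=; last first.
  rewrite mem_undup; apply/allpairsPdep; exists k, m.
  by rewrite mem_enum mcoeff_msupp.
rewrite mxE mcoeff_hcomp addrAC subrr add0r eqxx big1 ?addr0 // => t tk.
by rewrite mxE mcoeff_hcomp subr_eq addrC (negPf tk).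
Qed.

(** The homogeneous components of finitely many generators. *)
Lemma homog_generators_exist r (delta : 'I_r -> int) (U : 'rV[R]_r -> Prop) :
  submodule U -> (forall t u, U u -> U (rcomp delta t u)) ->
  exists G, homog_generators delta U G.
Proof.
move=> U_sub U_homog.
have [] := @noetherian_span R 'rV[R]_r [seq delta_mx 0 k | k <- enum 'I_r] U _ U_sub.
- exact/noetherian_mpoly/noetherian_field.
- move=> u _; rewrite [u]row_sum_delta; apply: submodule_sum => [|k _].
    exact: span_submodule.
  apply: submoduleZ; first exact: span_submodule.
  by apply/span_mem/map_f; rewrite mem_enum.
move=> s [Us sU].
have [L [LU Lhom sL]] : exists L : seq (int * 'rV[R]_r),
    [/\ forall x, x \in L -> U x.2,
        forall x, x \in L -> rcomp delta x.1 x.2 = x.2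
      & forall v, v \in s -> in_span [seq x.2 | x <- L] v].
  elim: s Us {sU} => [|v s IH] Us; first by exists [::].
  have [|L [LU Lhom sL]] := IH; first by move=> w ws; apply: Us; rewrite inE ws orbT.
  have [T vT] := rcomp_sum delta v.
  exists ([seq (t, rcomp delta t v) | t <- T] ++ L); split.
  - move=> x; rewrite mem_cat => /orP[/mapP[t _ ->]|/LU //] /=.
    by apply/U_homog/Us; rewrite mem_head.
  - move=> x; rewrite mem_cat => /orP[/mapP[t _ ->]|/Lhom //] /=.
    exact: rcompK.
  move=> w; rewrite inE map_cat => /orP[/eqP->|/sL].
    rewrite [X in in_span _ X]vT big_seq.
    apply: submodule_sum => [|t tT]; first exact: span_submodule.
    apply: span_mem; rewrite mem_cat -map_comp; apply/orP; left.
    by apply/mapP; exists t.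
  by move=> sw; apply: span_sub sw => x xs; rewrite mem_cat xs orbT.
pose B : 'M[R]_(size L, r) := \matrix_(i, k) (nth (0, 0) L i).2 0 k.
have rowB (i : 'I_(size L)) : row i B = (nth (0, 0) L i).2.
  by apply/rowP => k; rewrite !mxE.
exists (@Generators r (size L) (fun i => (nth (0, 0) L i).1) B); split=> /= [i k|u].
  have := Lhom _ (mem_nth (0, 0) (ltn_ord i)) => e.
  by apply/homogZP; rewrite mxE -{2}e [in RHS]mxE.
have im_sub : submodule (fun u : 'rV[R]_r => exists v, u = v *m B).
  split; first by exists 0; rewrite mul0mx.
  by move=> c _ _ [v ->] [w ->]; exists (c *: v + w); rewrite mulmxDl scalemxAl.
split=> [/sU/(span_min im_sub)|[v ->]].
  apply=> v /sL; apply: (span_min im_sub) => _ /mapP[x /(nthP (0, 0))[i iL <-] ->].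
  by exists (delta_mx 0 (Ordinal iL)); rewrite -rowE rowB.
rewrite mulmx_sum_row; apply: submodule_sum => // i _; apply: submoduleZ => //.
by rewrite rowB; apply/LU/mem_nth.
Qed.

(** Nakayama: a relation in which some generator has a coefficient with
    non-zero constant term contains, in the degree of that generator, one that
    expresses it by the others. *)
Lemma generators_shrink r (delta : 'I_r -> int) (U : 'rV[R]_r -> Prop) G :
  homog_generators delta U G -> ~ min_generators G ->
  exists2 G', homog_generators delta U G' & (gen_rank G' < gen_rank G)%N.
Proof.
case: G => N eps B [/= B_homog UB] not_min.
have [v vB [k vk]] : exists2 v : 'rV_N, v *m B = 0 & exists k, (v 0 k)@_0%MM != 0.
  apply: NNPP => H; case: not_min => v /= vB k; apply/eqP.
  by apply: contra_notT H => vk; exists v => //; exists k.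
case: N eps B k v B_homog UB {not_min} vB vk => [|N] eps B k v B_homog UB vB vk.
  by case: (k) => i; rewrite ltn0.
(* The component of [v] in the degree of the [k]-th generator, divided by its
   constant [k]-th coordinate. *)
set c := (v 0 k)@_0%MM in vk.
pose q : 'rV[R]_N.+1 := (c^-1)%:MP *: rcomp eps (eps k) v.
have qB : q *m B = 0.
  by rewrite -scalemxAl -(rcomp_mul B_homog) vB; apply/rowP => j; rewrite !mxE raddf0 mulr0.
have qk : q 0 k = 1.
  rewrite !mxE subrr; apply/mpolyP => m; rewrite mul_mpolyC mcoeffZ mcoeff_hcomp mcoeff1.
  rewrite eqz_nat eq_sym mdeg_eq0; case: eqP => [->|_]; last by rewrite mulr0.
  by rewrite mulVf.
have bumpE (u : 'rV[R]_N) (w : 'rV[R]_N.+1) : w 0 k = 0 -> u = col' k w ->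
    w *m B = u *m row' k B.
  move=> wk ->; apply/rowP => j; rewrite !mxE (bigD1_ord k) //= wk mul0r add0r.
  by apply: eq_bigr => i _; rewrite !mxE.
exists (@Generators r N (eps \o lift k) (row' k B)) => //; split=> /= [i j|u].
  by rewrite mxE; apply: B_homog.
rewrite UB; split=> [[w ->]|[w ->]].
  pose w' := w - w 0 k *: q.
  have -> : w *m B = w' *m B by rewrite mulmxBl -scalemxAl qB scaler0 subr0.
  exists (col' k w'); apply: bumpE => //.
  by rewrite !mxE; have := qk; rewrite !mxE => ->; rewrite mulr1 subrr.
exists (\row_j (if unlift k j is Some i then w 0 i else 0)); apply/esym/bumpE.
  by rewrite mxE unlift_none.
by apply/rowP => j; rewrite !mxE liftK.
Qed.

(** Generators in the least possible number are minimal. *)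
Lemma min_generators_exist r (delta : 'I_r -> int) (U : 'rV[R]_r -> Prop) :
  submodule U -> (forall t u, U u -> U (rcomp delta t u)) ->
  exists G, homog_generators delta U G /\ min_generators G.
Proof.
move=> U_sub /(homog_generators_exist U_sub)[G].
have [N] := ubnP (gen_rank G); elim: N G => // N IH G GN UG.
have [Gmin|/(generators_shrink UG)[G' UG' G'G]] := classic (min_generators G).
  by exists G.
by apply: IH UG'; apply: leq_trans G'G _.
Qed.

(** The state of the construction of a minimal resolution: a graded free module
    with the graded submodule that the next differential has to reach. *)
Record glevel := GLevel {
  lv_rank : nat;
  lv_deg : 'I_lv_rank -> int;
  lv_sub : 'rV[R]_lv_rank -> Prop;
  lv_submodule : submodule lv_sub;
  lv_graded : forall t u, lv_sub u -> lv_sub (rcomp lv_deg t u)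
}.

Definition lv_gen (l : glevel) : generators (lv_rank l) :=
  proj1_sig (constructive_indefinite_description _
    (min_generators_exist (lv_submodule l) (@lv_graded l))).

Lemma lv_genP l : homog_generators (@lv_deg l) (@lv_sub l) (lv_gen l) /\
  min_generators (lv_gen l).
Proof. by rewrite /lv_gen; case: constructive_indefinite_description. Qed.

Lemma lv_ker_submodule l :
  submodule (fun u : 'rV_(gen_rank (lv_gen l)) => u *m gen_mx (lv_gen l) = 0).
Proof.
split; first by rewrite mul0mx.
by move=> c u v u0 v0; rewrite mulmxDl -scalemxAl u0 v0 scaler0 addr0.
Qed.

Lemma lv_ker_graded l t (u : 'rV_(gen_rank (lv_gen l))) :
  u *m gen_mx (lv_gen l) = 0 ->
  rcomp (@gen_deg _ (lv_gen l)) t u *m gen_mx (lv_gen l) = 0.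
Proof.
move=> u0; have [[Bhom _] _] := lv_genP l.
by rewrite -(rcomp_mul Bhom) u0; apply/rowP => k; rewrite !mxE raddf0.
Qed.

Definition lv_next l : glevel := GLevel (@lv_ker_submodule l) (@lv_ker_graded l).

Section Resolution.
Variable I : R -> Prop.
Hypothesis I_sub : submodule (I : R^o -> Prop).
Hypothesis I_homog : forall t f, I f -> I (hcomp t f).

Lemma ideal_row_submodule : submodule (fun u : 'rV[R]_1 => I (u 0 0)).
Proof.
split; first by rewrite mxE; case: I_sub.
by move=> c u v Iu Iv; rewrite !mxE; apply: (I_sub.2).
Qed.

Lemma ideal_row_graded t (u : 'rV[R]_1) : I (u 0 0) -> I (rcomp (fun=> 0) t u 0 0).
Proof. by move=> Iu; rewrite mxE; apply: I_homog. Qed.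

Let level j := iter j lv_next (GLevel ideal_row_submodule ideal_row_graded).

Let res_aug : 'cV[R]_(lv_rank (level 1)) := gen_mx (lv_gen (level 0)).

Lemma res_aug_homog i : homogZ (lv_deg i) (res_aug i 0).
Proof. by have [[H _] _] := lv_genP (level 0); have := H i 0; rewrite subr0. Qed.

Lemma res_diff_homog j i k :
  homogZ (gen_deg i - lv_deg k) (gen_mx (lv_gen (level j.+1)) i k).
Proof. by have [[H _] _] := lv_genP (level j.+1). Qed.

Definition resolution : graded_free_complex K n :=
  @GradedFreeComplex K n (fun j => lv_rank (level j.+1))
    (fun j => @lv_deg (level j.+1)) (fun j => gen_mx (lv_gen (level j.+1)))
    res_aug res_diff_homog res_aug_homog.

Lemma resolutionP : is_minimal_resolution I resolution.
Proof.
have exact j (u : 'rV_(lv_rank (level j.+1))) : u *m gen_mx (lv_gen (level j)) = 0 <->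
    exists v : 'rV_(lv_rank (level j.+2)), u = v *m gen_mx (lv_gen (level j.+1)).
  by have [[_ H] _] := lv_genP (level j.+1); exact: H.
split; last first.
  move=> j i k /=.
  have [_ lvmin] := lv_genP (level j).
  have rel : row i (gen_mx (lv_gen (level j.+1))) *m gen_mx (lv_gen (level j)) = 0.
    by apply/exact; exists (delta_mx 0 i); rewrite -rowE.
  by have := lvmin _ rel k; rewrite mxE.
split=> [f|u|j u]; [|exact: (exact 0%N u)|exact: (exact j.+1 u)].
have [[_ H] _] := lv_genP (level 0).
have := H (\row_j f); rewrite /= mxE => ->; split=> -[v e]; exists v.
  by rewrite -[LHS](_ : (v *m gen_mx (lv_gen (level 0))) 0 0 = _) // -e mxE.
by apply/rowP => i; rewrite mxE -e !ord1.
Qed.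

End Resolution.

Lemma minimal_resolution_exists (I : R -> Prop) :
  submodule (I : R^o -> Prop) -> (forall t f, I f -> I (hcomp t f)) ->
  exists F : graded_free_complex K n, is_minimal_resolution I F.
Proof. by move=> HI HIh; exists (resolution HI HIh); apply: resolutionP. Qed.

End MinimalGenerators.

(** * Products of powers of ideals *)

Section Ideals.
Variable A : comNzRingType.
Implicit Types (G H I J : A -> Prop) (f g h c : A).

Lemma ideal_gen_submodule G : submodule (ideal_gen G : A^o -> Prop).
Proof.
split; first by exists [::]; rewrite big_nil.
move=> c _ _ [s [sG ->]] [t [tG ->]].
exists ([seq (c * u.1, u.2) | u <- s] ++ t); split.
  by move=> u; rewrite mem_cat => /orP[/mapP[v /sG Gv ->]|/tG].
rewrite big_cat big_map /GRing.scale /= mulr_sumr; congr (_ + _).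
by apply: eq_bigr => u _; rewrite mulrA.
Qed.

Lemma ideal_gen_mem G g : G g -> ideal_gen G g.
Proof.
move=> Gg; exists [:: (1, g)]; rewrite big_seq1 mul1r; split=> // u.
by rewrite inE => /eqP->.
Qed.

Lemma ideal_genM G c f : ideal_gen G f -> ideal_gen G (c * f).
Proof. exact: (@submoduleZ A A^o _ c f (ideal_gen_submodule G)). Qed.

Lemma ideal_gen_min G (U : A^o -> Prop) f :
  submodule U -> (forall g, G g -> U g) -> ideal_gen G f -> U f.
Proof.
move=> U_sub GU [s [sG ->]]; rewrite big_seq.
apply: (@submodule_sum _ A^o) => // u /sG/GU.
exact: (@submoduleZ A A^o U u.1 u.2 U_sub).
Qed.

Lemma ideal_gen_ext G H f :
  (forall g, G g <-> H g) -> ideal_gen G f <-> ideal_gen H f.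
Proof.
by move=> GH; split; apply: (ideal_gen_min (ideal_gen_submodule _)) => g /GH;
  apply: ideal_gen_mem.
Qed.

Lemma ideal_mul_ext I I' J J' f : (forall g, I g <-> I' g) ->
  (forall g, J g <-> J' g) -> ideal_mul I J f <-> ideal_mul I' J' f.
Proof.
move=> II JJ; split=> -[s [sIJ ->]]; exists s; split=> // u /sIJ;
  by rewrite II JJ.
Qed.

Lemma ideal_mul_gen G H f :
  ideal_mul (ideal_gen G) (ideal_gen H) f <->
  ideal_gen (fun x => exists g h, [/\ G g, H h & x = g * h]) f.
Proof.
split=> [[s [sIJ ->]]|[s [sGH ->]]].
  rewrite big_seq; apply: (@submodule_sum _ A^o) => [|u /sIJ[Gu Hu]].
    exact: ideal_gen_submodule.
  have sub1 : submodule (fun x : A^o => ideal_gen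
      (fun x => exists g h, [/\ G g, H h & x = g * h]) (x * u.2)).
    have S := ideal_gen_submodule (fun x => exists g h, [/\ G g, H h & x = g * h]).
    split; first by rewrite mul0r; case: S.
    by move=> c x y Sx Sy; rewrite mulrDl -mulrA; apply: S.2.
  apply: (ideal_gen_min sub1) Gu => g Gg.
  have sub2 : submodule (fun x : A^o => ideal_gen
      (fun x => exists g h, [/\ G g, H h & x = g * h]) (g * x)).
    have S := ideal_gen_submodule (fun x => exists g h, [/\ G g, H h & x = g * h]).
    split; first by rewrite mulr0; case: S.
    by move=> c x y Sx Sy; rewrite mulrDr mulrCA; apply: S.2.
  apply: (ideal_gen_min sub2) Hu => h Hh.
  by apply: ideal_gen_mem; exists g, h.
have /fin_all_exists[w Hw] : forall i : 'I_(size s), exists w : A * A,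
    [/\ G w.1, H w.2 & (nth (0, 0) s i).2 = w.1 * w.2].
  move=> i; have [g [h [Gg Hh e]]] := sGH _ (mem_nth (0, 0) (ltn_ord i)).
  by exists (g, h).
exists [seq ((nth (0, 0) s i).1 * (w i).1, (w i).2) | i : 'I_(size s)]; split.
  move=> _ /imageP[i _ ->]; have [Gw Hw' _] := Hw i; split=> /=.
    exact/ideal_genM/ideal_gen_mem.
  exact: ideal_gen_mem.
rewrite big_image (big_nth (0, 0)) big_mkord; apply: eq_bigr => i _ /=.
by have [_ _ ->] := Hw i; rewrite mulrA.
Qed.

End Ideals.

Section PowerProducts.
Variables (A : comNzRingType) (m : nat).
Implicit Types (G : 'I_m -> A -> Prop) (a b : 'I_m -> nat) (s : seq ('I_m * A)).

(** Only the number of factors from each [G i] matters, so that products can be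
    concatenated and split without an order on the indices. *)
Definition power_product G a (f : A) :=
  exists s, [/\ forall u, u \in s -> G u.1 u.2,
                forall i, count (fun u => u.1 == i) s = a i
              & f = \prod_(u <- s) u.2].

Definition ideal_prod G a := ideal_gen (power_product G a).

Lemma power_product_ext G a b f :
  a =1 b -> power_product G a f -> power_product G b f.
Proof. by move=> ab [s [sG sa ->]]; exists s; split=> // i; rewrite sa. Qed.

Lemma power_product0 G a : (forall i, a i = 0%N) -> power_product G a 1.
Proof. by move=> a0; exists [::]; rewrite big_nil; split=> // i; rewrite a0. Qed.

Lemma power_productM G a b f g : power_product G a f -> power_product G b g ->
  power_product G (fun i => a i + b i)%N (f * g).
Proof.
move=> [s [sG sa ->]] [t [tG tb ->]]; exists (s ++ t); rewrite big_cat; split=> //.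
  by move=> u; rewrite mem_cat => /orP[/sG|/tG].
by move=> i; rewrite count_cat sa tb.
Qed.

Lemma power_product1 G i g : G i g -> power_product G (fun j => (j == i) : nat) g.
Proof.
move=> Gg; exists [:: (i, g)]; rewrite big_seq1; split=> // [u|j].
  by rewrite inE => /eqP->.
by rewrite /= addn0 eq_sym.
Qed.

Lemma power_productS G i a f :
  power_product G (fun j => (j == i) + a j)%N f ->
  exists g h, [/\ G i g, power_product G a h & f = g * h].
Proof.
move=> [s [sG sa ->]].
have /hasP[u us /eqP ui] : has (fun u => u.1 == i) s.
  by rewrite has_count sa eqxx.
exists u.2, (\prod_(v <- rem u s) v.2); split.
- by rewrite -ui; apply: sG.
- exists (rem u s); split=> // [v /mem_rem/sG //|j].
  apply/(@addnI (j == i)); rewrite -sa.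
  by rewrite (permP (perm_to_rem us)) /= ui eq_sym.
- by rewrite (perm_big _ (perm_to_rem us)) big_cons.
Qed.

Lemma power_productD G a b f :
  power_product G (fun j => a j + b j)%N f ->
  exists g h, [/\ power_product G a g, power_product G b h & f = g * h].
Proof.
have [N] := ubnP (\sum_j a j); elim: N a b f => // N IH a b f aN PPf.
have [a0|] := boolP [forall i, a i == 0%N].
  exists 1, f; rewrite mul1r; split=> //.
    by apply: power_product0 => i; apply/eqP/(forallP a0).
  by apply: power_product_ext PPf => i; rewrite (eqP (forallP a0 i)).
rewrite negb_forall => /existsP[i ai].
pose a' j := (a j - (j == i))%N.
have aE j : a j = ((j == i) + a' j)%N.
  by rewrite /a' subnKC //; case: eqP => // ->; rewrite lt0n.
have [] := @power_productS G i (fun j => a' j + b j)%N f.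
  by apply: power_product_ext PPf => j; rewrite aE addnA.
move=> g [h [Gg PPh ->]].
have [|g' [h' [PPg' PPh' ->]]] := IH a' b h _ PPh.
  rewrite ltnS in aN; apply: leq_trans aN.
  rewrite (bigD1 i) // [X in (_ < X)%N](bigD1 i) //= aE eqxx ltnS.
  by apply: leq_add => //; apply: leq_sum => j _; rewrite leq_subr.
exists (g * g'), h'; split=> //; last by rewrite mulrA.
apply: power_product_ext (power_productM (power_product1 Gg) PPg') => j.
by rewrite aE.
Qed.

Lemma ideal_prod_ext G a b f : a =1 b -> ideal_prod G a f <-> ideal_prod G b f.
Proof.
by move=> ab; apply: ideal_gen_ext => g; split; apply: power_product_ext => i; rewrite ab.
Qed.

Lemma ideal_prod_submodule G a : submodule (ideal_prod G a : A^o -> Prop).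
Proof. exact: ideal_gen_submodule. Qed.

Lemma ideal_prod_mul G a b f :
  ideal_mul (ideal_prod G a) (ideal_prod G b) f <->
  ideal_prod G (fun i => a i + b i)%N f.
Proof.
rewrite ideal_mul_gen; apply: ideal_gen_ext => x; split=> [[g [h [Pg Ph ->]]]|].
  exact: power_productM.
exact: power_productD.
Qed.

Lemma ideal_prod1 G a f : (forall i, a i = 0%N) -> ideal_prod G a f.
Proof.
by move=> /power_product0-/(_ G) P1; rewrite -[f]mulr1; apply/ideal_genM/ideal_gen_mem.
Qed.

Lemma ideal_prod_delta G i f :
  ideal_gen (G i) f <-> ideal_prod G (fun j => (j == i) : nat) f.
Proof.
apply: ideal_gen_ext => g; split; first exact: power_product1.
move=> PPg; have [|h [k []]] := @power_productS G i (fun=> 0%N) g.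
  by apply: power_product_ext PPg => j; rewrite addn0.
move=> Gh [[|u s] [_ s0 ->]] ->; first by rewrite big_nil mulr1.
by have := s0 u.1; rewrite /= eqxx.
Qed.

Lemma ideal_powE G (I : A -> Prop) i k f : (forall g, I g <-> ideal_gen (G i) g) ->
  ideal_pow I k f <-> ideal_prod G (fun j => (j == i) * k)%N f.
Proof.
move=> IG; elim: k f => [|k IHk] f.
  by split=> // _; apply: ideal_prod1 => j; rewrite muln0.
rewrite /= (ideal_mul_ext f (I' := ideal_prod G (fun j => (j == i) : nat)) _ IHk).
  by rewrite ideal_prod_mul; apply: ideal_prod_ext => j; rewrite mulnS.
by move=> g; rewrite IG ideal_prod_delta.
Qed.

(** The product of the powers of ideals generated by the [G i] is generated by
    the products of elements of the [G i]. *)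
Lemma ideal_mpowE G (I : 'I_m -> A -> Prop) a f :
  (forall i g, I i g <-> ideal_gen (G i) g) ->
  ideal_mpow I a f <-> ideal_prod G a f.
Proof.
move=> IG; have aE : a =1 fun i => ((i \in index_enum 'I_m) * a i)%N.
  by move=> i; rewrite mem_index_enum mul1n.
rewrite (ideal_prod_ext G f aE) /ideal_mpow.
elim: (index_enum _) (index_enum_uniq 'I_m) f => [_|i r IH /andP[ir ur]] f.
  by rewrite big_nil; split=> // _; apply: ideal_prod1 => i; rewrite in_nil.
rewrite big_cons (ideal_mul_ext f (fun g => ideal_powE (a i) g (IG i)) (IH ur)).
rewrite ideal_prod_mul; apply: ideal_prod_ext => j; rewrite inE.
by case: eqP => [->|_] /=; rewrite ?(negPf ir) mul0n ?addn0.
Qed.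

End PowerProducts.

(** * Stability of intersections with the powers *)

Lemma finitely_generated_subset (A : comNzRingType) (V : lmodType A)
    (U : V -> Prop) (G : V -> Prop) :
  finitely_generated U ->
  (forall u, U u -> exists2 s, (forall v, v \in s -> G v) & in_span s u) ->
  exists2 s, (forall v, v \in s -> G v) & forall u, U u -> in_span s u.
Proof.
move=> [t [Ut tU]] UG.
have [s sG st] : exists2 s, (forall v, v \in s -> G v) & forall v, v \in t -> in_span s v.
  elim: t Ut {tU} => [|v t IH] Ut; first by exists [::].
  have [|s sG st] := IH; first by move=> w wt; apply: Ut; rewrite inE wt orbT.
  have [s' s'G s'v] := UG v (Ut v (mem_head _ _)).
  exists (s' ++ s) => [w|w]; first by rewrite mem_cat => /orP[/s'G|/sG].
  rewrite inE => /orP[/eqP->|/st]; first by apply: span_sub s'v => x; rewrite mem_cat => ->.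
  by apply: span_sub => x; rewrite mem_cat orbC => ->.
by exists s => // u /tU; apply: span_min => //; apply: span_submodule.
Qed.

Lemma ideal_gen_finite (A : comNzRingType) (G : A -> Prop) : noetherian A ->
  exists2 s : seq A, (forall g, g \in s -> G g) &
    forall f, ideal_gen G f <-> ideal_gen (fun g => g \in s) f.
Proof.
move=> noethA; have fg := noethA _ (ideal_gen_submodule G).
have [|s sG Gs] := @finitely_generated_subset A A^o _ G fg.
  move=> f [t [tG ->]]; exists (map snd t); first by move=> _ /mapP[u /tG Gu ->].
  rewrite big_seq; apply: (@submodule_sum _ A^o) => [|u ut]; first exact: span_submodule.
  apply: (@submoduleZ A A^o (in_span _)); first exact: span_submodule.
  by apply: (@span_mem A A^o); apply: map_f.
exists s => // f; split=> [/Gs|].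
  apply: (@span_min A A^o) => [|v vs]; first exact: ideal_gen_submodule.
  exact: ideal_gen_mem.
apply: (ideal_gen_min (ideal_gen_submodule G)) => g /sG; exact: ideal_gen_mem.
Qed.

Lemma noetherian_ffun (A : comNzRingType) (T : finType)
    (U : {ffun T -> A^o} -> Prop) :
  noetherian A -> submodule U -> finitely_generated U.
Proof.
move=> noethA U_sub.
apply: (@noetherian_span A _ [seq [ffun y : T => ((y == x)%:R : A^o)] | x <- enum T])
  => // u _.
have -> : u = \sum_x u x *: [ffun y : T => ((y == x)%:R : A^o)].
  apply/ffunP => y; rewrite sum_ffunE (bigD1 y) //= !ffunE eqxx.
  rewrite [_ *: 1]mulr1 big1 ?addr0 // => x xy.
  by rewrite !ffunE eq_sym (negPf xy) scaler0.
apply: submodule_sum => [|x _]; first exact: span_submodule.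
apply: submoduleZ; first exact: span_submodule.
by apply/span_mem/map_f; rewrite mem_enum.
Qed.

Section Stability.
Variables (A : comNzRingType) (m : nat) (L : seq ('I_m * A)) (T : finType).
Hypothesis noethA : noetherian A.
Let G i g := (i, g) \in L.
Local Notation N := (size L).
Local Notation vec B := {ffun T -> B^o}.
Implicit Types (a : 'I_m -> nat) (e k : 'X_{1..m}).

Let gen (l : 'I_N) : 'I_m * A := tnth (in_tuple L) l.

Let gen_in l : gen l \in L.
Proof. exact: mem_tnth. Qed.

(** A variable goes to the corresponding generator, in the degree of its ideal:
    the image of this map is the Rees algebra of the ideals. *)
Definition rees : {mpoly A[N]} -> {mpoly A[m]} :=
  mmap (@mpolyC m A) (fun l => (gen l).2 *: 'X_(gen l).1).

HB.instance Definition _ := GRing.RMorphism.on rees.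

(** The elements with this property form a subring that contains the images of
    the constants and of the variables. *)
Lemma rees_coeff (c : {mpoly A[N]}) e : ideal_prod G (fun i => e i) (rees c)@_e.
Proof.
pose P (q : {mpoly A[m]}) := forall e, ideal_prod G (fun i => e i) q@_e.
have P0 : P 0 by move=> k; rewrite mcoeff0; case: (ideal_prod_submodule G (fun i => k i)).
have PD p q : P p -> P q -> P (p + q).
  move=> Pp Pq k; rewrite mcoeffD.
  exact: (@submoduleD A A^o _ _ _ (ideal_prod_submodule G _) (Pp k) (Pq k)).
have PM p q : P p -> P q -> P (p * q).
  move=> Pp Pq k; rewrite mcoeffM.
  apply: (@submodule_sum _ A^o) => [|[k1 k2] /= /eqP kE]; first exact: ideal_prod_submodule.
  rewrite (ideal_prod_ext _ _ (b := fun i => k1 i + k2 i)%N) => [|i].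
    apply/ideal_prod_mul; exists [:: (p@_k1, q@_k2)]; rewrite big_seq1; split=> // u.
    by rewrite inE => /eqP->; split; [apply: Pp | apply: Pq].
  by have := congr1 (fun k : 'X_{1..m} => k i) kE; rewrite mnmDE.
have PC x : P x%:MP.
  move=> k; rewrite mcoeffC; case: eqP => [->|_].
    by rewrite mulr1; apply: ideal_prod1 => i; rewrite mnm0E.
  by rewrite mulr0; case: (ideal_prod_submodule G (fun i => k i)).
have PX l : P ((gen l).2 *: 'X_(gen l).1).
  move=> k; rewrite mcoeffZ mcoeffX; case: eqP => [<-|_]; last first.
    by rewrite mulr0; case: (ideal_prod_submodule G (fun i => k i)).
  rewrite mulr1 (ideal_prod_ext _ _ (b := fun j => (j == (gen l).1) : nat)) => [|j].
    by apply/ideal_prod_delta/ideal_gen_mem; rewrite /G -surjective_pairing.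
  by rewrite mnm1E eq_sym.
rewrite /rees /mmap; move: e; apply: (big_ind P) => // k _.
apply: (PM) => //; rewrite /mmap1; apply: (big_ind P) => [|//|l _].
  by rewrite -(mpolyC1 m).
by elim: (k l) => [|j IH]; rewrite ?expr0 -?(mpolyC1 m) // exprS; apply: (PM).
Qed.

(** Conversely, each component of the Rees algebra is reached. *)
Lemma rees_lift e f : ideal_prod G (fun i => e i) f ->
  exists c, rees c = f *: 'X_[e].
Proof.
have sub : submodule (fun f : A^o => exists c, rees c = f *: 'X_[e]).
  split; first by exists 0; rewrite (rmorph0 rees) scale0r.
  move=> c x y [p px] [q qy]; exists (c%:MP * p + q).
  rewrite (rmorphD rees) (rmorphM rees) /= px qy [rees c%:MP]mmapC scalerDl; congr (_ + _).
  by rewrite mul_mpolyC scalerA.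
apply: (ideal_gen_min sub) => _ [s [sG sa ->]].
have [c cE] : exists c, rees c = \prod_(u <- s) (u.2 *: 'X_u.1).
  elim: s sG {sa} => [|u s IH] sG; first by exists 1; rewrite (rmorph1 rees) big_nil.
  have [|c IHc] := IH; first by move=> v vs; apply: sG; rewrite inE vs orbT.
  have /tnthP[l ul] : (u.1, u.2) \in in_tuple L by apply/sG/mem_head.
  exists ('X_l * c); rewrite (rmorphM rees) /= IHc big_cons; congr (_ * _).
  by rewrite [LHS]mmapX mmap1U /gen -ul.
exists c; rewrite cE scaler_prod mprodXE.
congr (_ *: 'X_[_]); apply/mnmP => i; rewrite mnm_sumE -sa.
rewrite -sum1_count [RHS]big_mkcond; apply: eq_bigr => u _.
by rewrite mnm1E; case: eqP.
Qed.

(** A form of the lemma of Artin and Rees. The vectors over [{mpoly A[N]}] all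
    of whose components lie in [W] form a finitely generated module, and [b]
    bounds the degrees of the components of its generators. When an element of
    [W] with values in the product of exponent [e] plus the [i]-th unit vector
    is lifted and written in these generators, each coefficient that
    contributes still has a factor from the [i]-th ideal, to be taken out. *)
Theorem powers_stable (W : vec A -> Prop) : submodule W ->
  exists b : nat, forall e, (forall j, b <= e j)%N -> forall i (w : vec A), W w ->
    (forall x, ideal_prod G (fun j => (j == i) + e j)%N (w x)) ->
    exists s : seq (A * vec A),
      (forall u, u \in s -> [/\ (i, u.1) \in L, W u.2 &
          forall x, ideal_prod G (fun j => e j) (u.2 x)]) /\
      w = \sum_(u <- s) u.1 *: u.2.
Proof.
move=> W_sub.
pose coef (u : vec {mpoly A[N]}) e : vec A := [ffun x => (rees (u x))@_e].
(* The lifts to [{mpoly A[N]}] of elements of [W], in all degrees. *)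
pose U u := forall e, W (coef u e).
have coefM c u e : coef (c *: u) e = \sum_(k : 'X_{1..m < (mdeg e).+1, (mdeg e).+1} |
    e == (k.1 + k.2)%MM) (rees c)@_k.1 *: coef u k.2.
  apply/ffunP => x; rewrite sum_ffunE !ffunE (rmorphM rees) mcoeffM.
  by apply: eq_bigr => k _; rewrite !ffunE.
have coefD u v e : coef (u + v) e = coef u e + coef v e.
  by apply/ffunP => x; rewrite !ffunE (rmorphD rees) mcoeffD.
have U_sub : submodule U.
  split=> [e|c u v Uu Uv e].
    rewrite (_ : coef 0 e = 0); first by case: W_sub.
    by apply/ffunP => x; rewrite !ffunE (rmorph0 rees) mcoeff0.
  rewrite coefD; apply: submoduleD => //; rewrite coefM; apply: submodule_sum => // k _.
  exact: submoduleZ.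
have [us [Uus usU]] := noetherian_ffun (@noetherian_mpoly A N noethA) U_sub.
exists (\max_(u <- us) \max_x msize (rees (u x)))%N => e be i w Ww wI.
pose e' := (U_(i) + e)%MM.
have /fin_all_exists[c cw] : forall x, exists c, rees c = w x *: 'X_[e'].
  move=> x; apply: rees_lift; apply/ideal_prod_ext; last exact: wI.
  by move=> j; rewrite mnmDE mnm1E eq_sym.
pose u : vec {mpoly A[N]} := [ffun x => c x].
have coef_u k : coef u k = (e' == k)%:R *: w.
  apply/ffunP => x; rewrite !ffunE cw mcoeffZ mcoeffX.
  by rewrite /GRing.scale /= mulrC.
have /usU/spanE[d uE] : U u by move=> k; rewrite coef_u; apply: submoduleZ.
(* The combinations that the statement asks for. *)
pose Q (v : vec A) := exists s : seq (A * vec A),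
      (forall u, u \in s -> [/\ (i, u.1) \in L, W u.2 &
          forall x, ideal_prod G (fun j => e j) (u.2 x)]) /\
      v = \sum_(u <- s) u.1 *: u.2.
have Q_sub : submodule Q.
  split; first by exists [::]; rewrite big_nil.
  move=> a _ _ [s [sQ ->]] [t [tQ ->]].
  exists ([seq (v.1, a *: v.2) | v <- s] ++ t); split.
    move=> v; rewrite mem_cat => /orP[/mapP[y /sQ[Ly Wy Iy] ->]|/tQ //]; split=> //=.
      exact: submoduleZ.
    move=> x; rewrite ffunE.
    exact: (@submoduleZ A A^o _ _ _ (ideal_prod_submodule _ _) (Iy x)).
  rewrite big_cat big_map scaler_sumr; congr (_ + _); apply: eq_bigr => v _.
  by rewrite !scalerA mulrC.
suff : Q (coef u e') by rewrite coef_u eqxx scale1r.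
have -> : coef u e' = \sum_k coef (d k *: us`_k) e'.
  rewrite {1}uE; apply: (big_morph (fun v => coef v e')) => [v1 v2|].
    exact: coefD.
  by apply/ffunP => x; rewrite !ffunE (rmorph0 rees) mcoeff0.
apply: submodule_sum => // l _; rewrite coefM; apply: submodule_sum => // -[k1 k2] /= /eqP kE.
have le_mdeg k j : (k j <= mdeg k)%N by rewrite mdegE (bigD1 j) //= leq_addr.
have v_us : us`_l \in us by rewrite mem_nth.
move: (us`_l) v_us => v v_us; set y := coef v k2.
have kj j : ((j == i) + e j)%N = (k1 j + k2 j)%N.
  by have := congr1 (fun k : 'X_{1..m} => k j) kE; rewrite !mnmDE mnm1E eq_sym.
(* If [k2] exceeds [e] somewhere, it exceeds the bound, and [y] is zero. *)
have [k2e|] := boolP [forall j, k2 j <= e j]%N; last first.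
  rewrite negb_forall => /existsP[j]; rewrite -ltnNge => ej.
  suff -> : y = 0 by rewrite scaler0; case: Q_sub.
  apply/ffunP => x; rewrite !ffunE; apply: memN_msupp_eq0.
  apply: msize_mdeg_ge; apply: leq_trans (le_mdeg k2 j).
  apply: leq_trans (ltnW ej); apply: leq_trans (be j).
  apply: leq_trans (leq_bigmax_seq _ v_us isT).
  exact: (leq_bigmax x).
have yI x : ideal_prod G (fun j => k2 j) (y x) by rewrite ffunE; apply: rees_coeff.
have k1E : (fun j => k1 j) =1 (fun j => (j == i) + (e j - k2 j))%N.
  by move=> j; rewrite addnBA ?(forallP k2e) // kj addnK.
have sub : submodule (fun x : A^o => Q (x *: y)).
  split; first by rewrite scale0r; case: Q_sub.
  by move=> a x1 x2 Q1 Q2; rewrite scalerDl -scalerA; apply: Q_sub.2.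
have /(ideal_prod_ext _ _ k1E) := rees_coeff (d l) k1.
apply: (ideal_gen_min sub) => _ /power_productS[g [h [Lg Ph ->]]].
exists [:: (g, h *: y)]; rewrite big_seq1 /= scalerA; split=> // z.
rewrite inE => /eqP->; split=> //= [|x]; first by apply: submoduleZ => //; apply: Uus.
rewrite ffunE (ideal_prod_ext _ _ (b := fun j => (e j - k2 j) + k2 j)%N) => [|j].
  apply/ideal_prod_mul; exists [:: (h, y x)]; rewrite big_seq1; split=> // z'.
  by rewrite inE => /eqP->; split; [apply: ideal_gen_mem Ph | apply: yI].
by rewrite subnK ?(forallP k2e).
Qed.

End Stability.

(** * Asymptotic behaviour *)

Section ForLarge.
Variable m : nat.
Implicit Types (P Q : ('I_m -> nat) -> Prop).

Lemma for_large_mono P Q : (forall a, P a -> Q a) -> for_large P -> for_large Q.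
Proof. by move=> PQ [b Pb]; exists b => a /Pb/PQ. Qed.

Lemma for_large_and P Q : for_large P -> for_large Q -> for_large (fun a => P a /\ Q a).
Proof.
move=> [b Pb] [c Qc]; exists (fun i => maxn (b i) (c i)) => a ab.
by split; [apply: Pb | apply: Qc] => i; apply: leq_trans (ab i); rewrite ?leq_maxl ?leq_maxr.
Qed.

Lemma for_large_all (T : finType) (P : T -> ('I_m -> nat) -> Prop) :
  (forall x, for_large (P x)) -> for_large (fun a => forall x, P x a).
Proof.
move=> /fin_all_exists[b Pb]; exists (fun i => \max_x b x i) => a ab x; apply: Pb => i.
by apply: leq_trans (ab i); apply: (leq_bigmax x).
Qed.

Lemma for_large_ex P : for_large P -> exists a, P a.
Proof. by move=> [b Pb]; exists b; apply: Pb. Qed.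

End ForLarge.

Lemma seq_int_max (s : seq int) :
  s != [::] -> exists2 x, x \in s & forall y, y \in s -> y <= x.
Proof.
elim: s => // x [|y s] IH _.
  by exists x => [|z]; rewrite inE // => /eqP->.
have [//|z zs zmax] := IH; exists (Num.max x z).
  by rewrite inE; case: leP => _; rewrite ?zs ?eqxx ?orbT.
move=> w; rewrite inE => /orP[/eqP->|/zmax wz]; first by rewrite le_max lexx.
by rewrite le_max wz orbT.
Qed.

Section PowersOfHomogeneousIdeals.
Variables (K : fieldType) (n m : nat).
Local Notation R := {mpoly K[n]}.
Variables (L : seq ('I_m * R)) (d : 'I_m -> nat).
Hypothesis L_homog : forall u, u \in L -> u.2 \is (d u.1).-homog.
Let G i g := (i, g) \in L.
Local Notation J := (ideal_prod G).
Implicit Types (a : 'I_m -> nat) (t e : int) (p : nat).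

Definition wdeg a : int := \sum_(i < m) (d i)%:Z * (a i)%:Z.

Lemma power_product_homog a f : power_product G a f -> homogZ (wdeg a) f.
Proof.
move=> [s [sG sa ->]].
have -> : wdeg a = (\sum_(u <- s) d u.1)%N.
  rewrite /wdeg (eq_bigr (fun i => (d i * a i)%:Z)) => [|i _]; last by rewrite PoszM.
  rewrite -(big_morph Posz PoszD (erefl _)); congr (Posz _).
  rewrite (eq_bigr (fun i => \sum_(u <- s) if u.1 == i then d i else 0)%N) => [|i _].
    rewrite exchange_big; apply: eq_bigr => u _.
    by rewrite -big_mkcond /= (big_pred1 u.1) // => i; rewrite eq_sym.
  by rewrite -sa -big_mkcond /= big_const_seq iter_addn_0.
rewrite /=; elim: s sG {sa} => [|u s IH] sG; first by rewrite !big_nil dhomog1.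
rewrite !big_cons; apply: dhomogM.
  by apply: L_homog; have := sG u (mem_head _ _); rewrite /G -surjective_pairing.
by apply: IH => v vs; apply: sG; rewrite inE vs orbT.
Qed.

Lemma ideal_prod_hcomp a t f : J a f -> J a (hcomp t f).
Proof.
have sub : submodule (fun f : R^o => J a f) by apply: ideal_prod_submodule.
move=> [s [sG ->]]; rewrite raddf_sum big_seq.
apply: (@submodule_sum _ R^o) => // u /sG PPu /=.
rewrite (hcompM _ _ (power_product_homog PPu)).
exact/ideal_genM/ideal_gen_mem.
Qed.

(** Vanishing of Koszul homology of a product, in a degree counted from
    that of its generators. *)
Definition prod_vanish p e a := koszul_vanish (ring_grading K n) p (wdeg a + e) (J a).

Lemma prod_vanish_ext p e a a' : a =1 a' -> prod_vanish p e a -> prod_vanish p e a'.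
Proof.
move=> aa'; rewrite /prod_vanish.
have -> : wdeg a' = wdeg a by apply: eq_bigr => i _; rewrite aa'.
have [|//] := @koszul_vanish_ext K n R^o (ring_grading K n) p (wdeg a + e) (J a) (J a').
by move=> f; apply: ideal_prod_ext.
Qed.

(** A cycle of the larger product is, by [powers_stable], a combination of
    cycles of the smaller one with coefficients of degree [d i]. Taking the
    component of the right degree of these, they become boundaries, and so
    does their combination. *)
Lemma prod_vanish_step p : exists b : nat, forall a, (forall j, b <= a j)%N ->
  forall i e, prod_vanish p e a -> prod_vanish p e (fun j => (j == i) + a j)%N.
Proof.
(* The [p]-cycles of [R]. *)
pose W (w : {ffun {set 'I_n} -> R^o}) :=
  koszul w = 0 /\ forall A : {set 'I_n}, #|A| != p -> w A = 0.
have W_sub : submodule W.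
  split; first by split; [rewrite linear0 | move=> A _; rewrite ffunE].
  move=> c u v [ku u0] [kv v0]; split; first by rewrite linearP /= ku kv scaler0 addr0.
  by move=> A Ap; rewrite !ffunE u0 ?v0 ?scaler0 ?addr0.
have noeth : noetherian R by apply/noetherian_mpoly/noetherian_field.
have [b Hb] := @powers_stable R m L {set 'I_n} noeth W W_sub.
exists b => a ba i e; set a' := (X in _ -> prod_vanish _ _ X) => van z zp zc zt.
have [|||s [sP zE]] := Hb [multinom a j | j < m] _ i z.
- by move=> j; rewrite mnmE.
- by split=> //; case: zp.
- move=> A; apply/(ideal_prod_ext _ _ (b := a')); last by case: zp.
  by move=> j; rewrite mnmE.
have wdegE : wdeg a' = (d i)%:Z + wdeg a.
  pose F j := (d j)%:Z * (j == i)%:Z + (d j)%:Z * (a j)%:Z.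
  rewrite /wdeg /a' (eq_bigr F) => [|j _]; rewrite /F.
    rewrite big_split /=; congr (_ + _); rewrite (bigD1 i) //= eqxx mulr1 big1 ?addr0 //.
    by move=> j /negPf->; rewrite mulr0.
  by rewrite PoszD mulrDr.
pose B (y : {ffun {set 'I_n} -> R^o}) :=
  exists2 w : {ffun {set 'I_n} -> R^o}, @kchain K n R^o p.+1 (J a') w & koszul w = y.
have B_sub : submodule B.
  have Jsub : @submodule R R^o (J a') by apply: ideal_prod_submodule.
  split; first by exists 0; [case: (kchain_submodule p.+1 Jsub) | rewrite linear0].
  move=> c _ _ [w wJ <-] [v vJ <-]; exists (c *: w + v); last by rewrite linearP.
  exact: (kchain_submodule p.+1 Jsub).2.
(* The component that, multiplied by a generator of degree [d i], contributes to
   the degree of [z]. *)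
pose u' (u : {ffun {set 'I_n} -> R^o}) : {ffun {set 'I_n} -> R^o} :=
  [ffun A : {set 'I_n} => ring_grading K n (wdeg a + e - p%:Z) (u A)].
have -> : z = \sum_(u <- s) u.1 *: u' u.2.
  apply/ffunP => A; rewrite -[LHS]zt {1}zE !sum_ffunE raddf_sum big_seq [RHS]big_seq.
  apply: eq_bigr => u /sP[Lu _ _]; rewrite !ffunE /= /GRing.scale /= mulrC.
  rewrite (@hcompM _ _ (d i)%:Z); last exact: (L_homog Lu).
  by rewrite mulrC wdegE; congr (_ * hcomp _ _); rewrite -!addrA addrC !addrA subrK.
rewrite big_seq; apply: (submodule_sum (U := B)) => // u /sP[Lu [ku u0] Ju].
have JE A : J a (u.2 A).
  by apply/(ideal_prod_ext _ _ (a := fun j => [multinom a j | j < m] j)) => // j; rewrite mnmE.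
have [|||w [Jw w0] wu] := van (u' u.2).
- split=> A; rewrite ffunE; first exact: ideal_prod_hcomp.
  by move=> /u0 ->; rewrite raddf0.
- by rewrite koszul_comp; apply/ffunP => A; rewrite ffunE ku !ffunE raddf0.
- by move=> A; rewrite ffunE gcompK.
exists (u.1 *: w); last by rewrite linearZ /= wu.
split=> A; rewrite ffunE; last by move=> /w0 ->; rewrite scaler0.
apply/ideal_prod_mul; exists [:: (u.1, w A)]; rewrite big_seq1; split=> // v.
rewrite inE => /eqP->; split; last exact: Jw.
exact/ideal_prod_delta/ideal_gen_mem.
Qed.

Lemma prod_vanish_mono p : exists b : nat, forall a a' e,
  (forall j, b <= a j)%N -> (forall j, a j <= a' j)%N ->
  prod_vanish p e a -> prod_vanish p e a'.
Proof.
have [b Hb] := prod_vanish_step p; exists b => a a' e.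
have [N] := ubnP (\sum_j (a' j - a j))%N; elim: N a => // N IH a aN ba aa' van.
have [a'a|] := boolP [forall j, a' j <= a j]%N.
  apply: prod_vanish_ext van => j; apply/eqP.
  by rewrite eqn_leq aa' (forallP a'a).
rewrite negb_forall => /existsP[i]; rewrite -ltnNge => ai.
apply: (IH (fun j => (j == i) + a j)%N) (Hb _ ba i e van).
- rewrite ltnS in aN; apply: leq_trans aN.
  rewrite (bigD1 i) // [X in (_ < X)%N](bigD1 i) //= eqxx -addSn leq_add //.
    by rewrite add1n subnSK.
  by apply: leq_sum => j _; rewrite leq_sub2l // leq_addl.
- by move=> j; apply: leq_trans (ba j) _; rewrite leq_addl.
- by move=> j; case: eqP => [->|_] /=; rewrite ?add1n ?add0n.
Qed.

Hypothesis J_neq0 : forall a, exists2 f, J a f & f != 0.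

Lemma prod_resolution a :
  exists F : graded_free_complex K n, is_minimal_resolution (J a) F.
Proof.
apply: minimal_resolution_exists; first exact: ideal_prod_submodule.
by move=> t f; apply: ideal_prod_hcomp.
Qed.

(** The shifts that occur at the bound of [prod_vanish_mono] are finitely many,
    because a minimal resolution has finite ranks; none is added later, and
    one that disappears never comes back. *)
Lemma shifts_stabilise p : exists E : seq int,
  for_large (fun a => forall e, prod_vanish p e a <-> e \notin E).
Proof.
have [b Hb] := prod_vanish_mono p.
have [F F_min] := prod_resolution (fun=> b).
(* The shifts that occur at the bound. *)
have [E0 HE0] : exists E0 : seq int, forall e, e \notin E0 -> prod_vanish p e (fun=> b).
  exists [seq @gf_deg _ _ F p k - wdeg (fun=> b) | k : 'I_(gf_rank F p)] => e eE.
  apply/(koszul_vanish_betti F_min) => k; apply: contra eE => /eqP kE.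
  by apply/imageP; exists k => //; rewrite kE addrAC subrr add0r.
have [E HE] : exists E : seq int, for_large (fun a => forall e, e \in E0 ->
    (prod_vanish p e a <-> e \notin E)) /\ {subset E <= E0}.
  elim: E0 {HE0} => [|e E0 [E [HE EE0]]]; first by exists [::]; split=> //; exists (fun=> 0%N).
  have [eE0|eE0] := boolP (e \in E0).
    exists E; split=> [|x /EE0 xE0]; last by rewrite inE xE0 orbT.
    apply: for_large_mono HE => a HE x; rewrite inE => /orP[/eqP->|]; exact: HE.
  have [[a0 [ba0 van]]|never] :=
    classic (exists a, (forall j, b <= a j)%N /\ prod_vanish p e a).
    exists E; split=> [|x /EE0 xE0]; last by rewrite inE xE0 orbT.
    have large : for_large (fun a => prod_vanish p e a).
      by exists a0 => a a0a; apply: Hb van.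
    apply: for_large_mono (for_large_and HE large) => a [{}HE ea] x.
    rewrite inE => /orP[/eqP->|]; last exact: HE.
    by split=> // _; apply: contra eE0; apply: EE0.
  exists (e :: E); split=> [|x]; last first.
    by rewrite !inE => /orP[->//|/EE0->]; rewrite orbT.
  have large : for_large (fun a => ~ prod_vanish p e a).
    by exists (fun=> b) => a ba ea; apply: never; exists a.
  apply: for_large_mono (for_large_and HE large) => a [{}HE ea] x.
  rewrite !inE; case: eqP => [-> _|_] //=; exact: HE.
exists E; have large : for_large (fun a => forall e, e \notin E0 -> prod_vanish p e a).
  exists (fun=> b) => a ba e /HE0; exact: Hb.
case: HE => HE EE0; apply: for_large_mono (for_large_and HE large) => a [{}HE ea] e.
have [/HE//|eE0] := boolP (e \in E0).
by split=> _; [apply: contra eE0; apply: EE0 | apply: ea].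
Qed.

Lemma prod_vanish_gt p e a : (n < p)%N -> prod_vanish p e a.
Proof.
move=> np z [_ z0] _ _; exists 0.
  by split=> A; rewrite ffunE //; case: (ideal_prod_submodule G a).
rewrite linear0; apply/ffunP => A; rewrite ffunE z0 // neq_ltn.
by rewrite (leq_ltn_trans _ np) // -[X in (_ <= X)%N]card_ord max_card.
Qed.

Lemma shifts_exist : exists E : nat -> seq int,
  for_large (fun a => forall p e, prod_vanish p e a <-> e \notin E p) /\
  (forall p, (n < p)%N -> E p = [::]).
Proof.
have /fin_all_exists[E HE] : forall p : 'I_n.+1, exists E : seq int,
    for_large (fun a => forall e, prod_vanish p e a <-> e \notin E).
  by move=> p; apply: shifts_stabilise.
exists (fun p => if (p <= n)%N then E (inord p) else [::]); split; last first.
  by move=> p; rewrite ltnNge => /negPf->.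
apply: for_large_mono (for_large_all HE) => a {}HE p e; case: leqP => [pn|np].
  by have := HE (inord p) e; rewrite inordK.
by split=> // _; apply: prod_vanish_gt.
Qed.


(** For large [a], the stable set of shifts [E j] consists of the degrees of the
    basis of [F_j], counted from [wdeg a]. These sets are non-empty up to the
    projective dimension, and their greatest elements are the constant
    terms. *)
Lemma ideal_prod_asymptotics :
  (exists p : nat,
     for_large (fun a => is_pd_ideal (J a) p) /\
     (forall j : nat, (j <= p)%N -> exists lambda : int,
        for_large (fun a => is_t (J a) j (wdeg a + lambda)))) /\
  (exists lambda0 : int, for_large (fun a => is_reg (J a) (wdeg a + lambda0))).
Proof.
have [E [HE En]] := shifts_exist.
have degE a (F : graded_free_complex K n) p e : is_minimal_resolution (J a) F ->
    (forall p e, prod_vanish p e a <-> e \notin E p) ->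
    (e \in E p) = [exists k, @gf_deg _ _ F p k == wdeg a + e].
  move=> F_min Ha; apply/idP/idP; apply: contraTT.
    by rewrite negb_exists => /forallP H; apply/Ha/(koszul_vanish_betti F_min).
  by move=> /Ha/(koszul_vanish_betti F_min) H; rewrite negb_exists; apply/forallP.
have rankE a (F : graded_free_complex K n) p : is_minimal_resolution (J a) F ->
    (forall p e, prod_vanish p e a <-> e \notin E p) ->
    (E p == [::]) = (gf_rank F p == 0%N).
  move=> F_min Ha; apply/eqP/eqP => [Ep|Fp].
    case r : (gf_rank F p) => [//|r'].
    have k : 'I_(gf_rank F p) by rewrite r; exact: ord0.
    have := degE a F p (gf_deg k - wdeg a) F_min Ha; rewrite Ep in_nil => /esym/negbT.
    by rewrite negb_exists => /forallP/(_ k); rewrite addrC subrK eqxx.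
  case e : (E p) => [//|x s].
  have := degE a F p x F_min Ha; rewrite e mem_head => /esym/existsP[k _].
  by have := ltn_ord k; rewrite {2}Fp.
have [a0 Ha0] := for_large_ex HE.
have [F0 F0_min] := prod_resolution a0.
have E0 : E 0%N != [::].
  rewrite (rankE a0 F0) //; apply/eqP => r0.
  have [f Jf f0] := J_neq0 a0; have [[/(_ f)[/(_ Jf)[u uf] _] _ _] _] := F0_min.
  case/eqP: f0; rewrite -uf mxE big1 // => i _.
  by have := ltn_ord i; rewrite {2}r0.
(* A minimal resolution that stops once does not start again. *)
have E_down p : E p = [::] -> E p.+1 = [::].
  move=> /eqP; rewrite (rankE a0 F0) // => /eqP/(gf_rank_eq0 F0_min)/eqP.
  by rewrite -(rankE a0 F0) // => /eqP.
have Ebound p : E p != [::] -> (p <= n)%N.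
  by apply: contraR; rewrite -ltnNge => /En ->.
have [p Ep pmax] := ex_maxnP (ex_intro (fun p => E p != [::]) 0%N E0) Ebound.
have Ele j : (j <= p)%N -> E j != [::].
  move=> jp; apply: contra Ep => /eqP Ej; rewrite -(subnKC jp).
  elim: (p - j)%N => [|i IH]; first by rewrite addn0 Ej.
  by rewrite addnS; apply/eqP/E_down/eqP.
have /fin_all_exists[lam Hlam] : forall j : 'I_p.+1, exists l,
    l \in E j /\ forall x, x \in E j -> x <= l.
  by move=> j; have [l lE lmax] := seq_int_max (Ele j (ltn_ord j)); exists l.
split.
  exists p; split=> [|j jp].
    apply: for_large_mono HE => a Ha; have [F F_min] := prod_resolution a.
    apply: (is_pd_ideal_minimal F_min) => [|j pj]; first by rewrite -(rankE a F).
    apply/eqP; rewrite -(rankE a F) //; apply/negPn/negP => /pmax.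
    by rewrite leqNgt pj.
  have [lamE lam_max] := Hlam (inord j); rewrite inordK // in lamE lam_max.
  exists (lam (inord j)); apply: for_large_mono HE => a Ha.
  have [F F_min] := prod_resolution a; exists F => //; split.
    by move: lamE; rewrite (degE a F) // => /existsP[k /eqP]; exists k.
  move=> k; rewrite -lerBlDl; apply: lam_max; rewrite (degE a F) //.
  by apply/existsP; exists k; rewrite addrC subrK.
have [|l lE lmax] := @seq_int_max [seq lam j - j%:Z | j : 'I_p.+1].
  by rewrite -size_eq0 size_image card_ord.
exists l; apply: for_large_mono HE => a Ha; split.
  have /imageP[j _ lj] := lE; have [lamE lam_max] := Hlam j.
  have [F F_min] := prod_resolution a; exists j, (wdeg a + lam j); split.
    exists F => //; split.
      by move: lamE; rewrite (degE a F) // => /existsP[k /eqP]; exists k.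
    move=> k; rewrite -lerBlDl; apply: lam_max; rewrite (degE a F) //.
    by apply/existsP; exists k; rewrite addrC subrK.
  by rewrite lj addrA.
move=> j t [F F_min [[k kt] _]].
have tE : t - wdeg a \in E j.
  by rewrite (degE a F) //; apply/existsP; exists k; rewrite kt addrC subrK.
have jp : (j < p.+1)%N by rewrite ltnS; apply: pmax; case: (E j) tE.
have [_ lam_max] := Hlam (Ordinal jp).
have lj : lam (Ordinal jp) - j%:Z <= l.
  by apply: lmax; apply/imageP; exists (Ordinal jp).
rewrite -lerBlDl addrAC; apply: le_trans lj.
by rewrite lerD2r; apply: lam_max.
Qed.

End PowersOfHomogeneousIdeals.

Lemma ideal_mul_mem (A : comNzRingType) (I J : A -> Prop) f g :
  I f -> J g -> ideal_mul I J (f * g).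
Proof.
move=> If Jg; exists [:: (f, g)]; rewrite big_seq1; split=> // u.
by rewrite inE => /eqP->.
Qed.

Lemma ideal_mpow_neq0 (A : idomainType) m (I : 'I_m -> A -> Prop) a :
  (forall i, exists2 f, I i f & f != 0) -> exists2 f, ideal_mpow I a f & f != 0.
Proof.
move=> I_neq0; rewrite /ideal_mpow.
apply: (big_ind (fun J : A -> Prop => exists2 f, J f & f != 0)).
- by exists 1; rewrite ?oner_eq0.
- move=> J J' [f Jf f0] [g Jg g0]; exists (f * g); last by rewrite mulf_neq0.
  exact: ideal_mul_mem.
- move=> i _; have [f If f0] := I_neq0 i.
  elim: (a i) => [|k [g Ig g0]]; first by exists 1; rewrite ?oner_eq0.
  by exists (f * g); [apply: ideal_mul_mem | rewrite mulf_neq0].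
Qed.

Theorem corollary2p3 (K : fieldType) (n m : nat)
    (I : 'I_m -> {mpoly K[n]} -> Prop) (d : 'I_m -> nat)
    (I_homog : forall i, homogeneous_ideal (I i))
    (I_neq0 : forall i, exists2 f, I i f & f != 0)
    (I_deg : forall i, generated_in_degree (I i) (d i)) :
  (exists p : nat,
     for_large (fun a => is_pd_ideal (ideal_mpow I a) p) /\
     (forall j : nat, (j <= p)%N ->
        exists lambda : int,
          for_large (fun a =>
            is_t (ideal_mpow I a) j
              (\sum_(i < m) (d i)%:Z * (a i)%:Z + lambda)))) /\
  (exists lambda0 : int,
     for_large (fun a =>
       is_reg (ideal_mpow I a)
         (\sum_(i < m) (d i)%:Z * (a i)%:Z + lambda0))).
Proof.
have noeth : noetherian {mpoly K[n]} by apply/noetherian_mpoly/noetherian_field.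
have /fin_all_exists[s Hs] : forall i, exists s : seq {mpoly K[n]},
    (forall g, g \in s -> g \is (d i).-homog) /\
    forall f, I i f <-> ideal_gen (fun g => g \in s) f.
  move=> i; have [G [G_homog IG]] := I_deg i.
  have [s sG Gs] := ideal_gen_finite G noeth.
  by exists s; split=> [g /sG/G_homog //|f]; rewrite IG Gs.
pose L := [seq (i, g) | i <- enum 'I_m, g <- s i].
have memL i g : ((i, g) \in L) = (g \in s i).
  apply/allpairsPdep/idP => [[j [h [_ hs [-> ->]]]] //|gs].
  by exists i, g; rewrite mem_enum.
have L_homog u : u \in L -> u.2 \is (d u.1).-homog.
  by case: u => i g; rewrite memL; case: (Hs i) => + _; apply.
have IE a : ideal_mpow I a = ideal_prod (fun i g => (i, g) \in L) a.
  apply: functional_extensionality => f; apply: propositional_extensionality.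
  apply: ideal_mpowE => i g; have [_ ->] := Hs i.
  by apply: ideal_gen_ext => h; rewrite memL.
have J_neq0 a : exists2 f, ideal_prod (fun i g => (i, g) \in L) a f & f != 0.
  by rewrite -IE; apply: ideal_mpow_neq0.
have [[p [pd_p t_p]] [l reg_l]] := ideal_prod_asymptotics L_homog J_neq0.
split; last by exists l; apply: for_large_mono reg_l => a; rewrite IE.
exists p; split=> [|j /t_p[lam t_lam]].
  by apply: for_large_mono pd_p => a; rewrite IE.
by exists lam; apply: for_large_mono t_lam => a; rewrite IE.
Qed.
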